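(* Let $\mathcal{B}$ be an unbounded closed densely defined symmetric operator in $\mathcal{H}$. Then there are infinitely many pairs $\langle\mathcal{B}_1,\mathcal{B}_2\rangle$ of closed densely defined restrictions of $\mathcal{B}$ such that (1) $\operatorname{dom}\mathcal{B}_1\cap\operatorname{dom}\mathcal{B}_2=\{0\}$; (2) $\operatorname{dom}\mathcal{B}=\operatorname{dom}\mathcal{B}_1\dotplus\operatorname{dom}\mathcal{B}_2$; (3) $\operatorname{dom}\mathcal{B}_1\cap\operatorname{dom}(\mathcal{B}^*\mathcal{B})=\operatorname{dom}\mathcal{B}_2\cap\operatorname{dom}(\mathcal{B}^*\mathcal{B})=\{0\}$; (4) $\operatorname{dom}(\mathcal{B}^*\mathcal{B}_1)=\operatorname{dom}(\mathcal{B}^*\mathcal{B}_2)=\{0\}$; in particular $\operatorname{dom}\mathcal{B}_1^2=\operatorname{dom}\mathcal{B}_2^2=\{0\}$. If moreover $0$ is a point of regular type for $\mathcal{B}$ (i.e. $\|\mathcal{B}f\|\ge c\|f\|$ for some $c>0$ and all $f\in\operatorname{dom}\mathcal{B}$), then for $j=1,2$: (5) $\mathcal{B}_j\mathcal{B}^*$ is densely defined (and non-negative symmetric); (6) $\mathcal{B}\mathcal{B}^*$ is the Friedrichs extension of $\mathcal{B}_j\mathcal{B}^*$; (7) $(\mathcal{B}_j\mathcal{B}^* )^*=\mathcal{B}\mathcal{B}_j^*$; (8) $\operatorname{dom}(\mathcal{B}_1\mathcal{B}^* )\cap\operatorname{dom}(\mathcal{B}_2\mathcal{B}^* )=\ker\mathcal{B}^*$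 and $\operatorname{dom}(\mathcal{B}_1\mathcal{B}^* )+\operatorname{dom}(\mathcal{B}_2\mathcal{B}^* )=\operatorname{dom}(\mathcal{B}\mathcal{B}^* )$; (9) the Kreĭn extension of $\mathcal{B}_j\mathcal{B}^*$ is $\mathcal{B}_j\mathcal{B}_j^*$.
   Context: $\mathcal{H}$ is a complex, infinite-dimensional, separable Hilbert space. Products of unbounded operators have their natural domains, $\operatorname{dom}(ST)=\{f\in\operatorname{dom}T:Tf\in\operatorname{dom}S\}$. For a densely defined closed non-negative symmetric operator $\mathcal{A}$: the Friedrichs extension is the non-negative self-adjoint operator associated with the closure of the form $(\mathcal{A}f,g)$ on $\operatorname{dom}\mathcal{A}$ (maximal non-negative self-adjoint extension); the Kreĭn extension $\mathcal{A}_K$ is the minimal non-negative self-adjoint extension, i.e. $(\mathcal{A}_F+aI)^{-1}\le(\mathcal{C}+aI)^{-1}\le(\mathcal{A}_K+aI)^{-1}$, $a>0$, for every non-negative self-adjoint extension $\mathcal{C}$. $\dotplus$ denotes a direct sum. *)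

(* Defs.v *)
(* complex scalars C := R[i] over R : realType (so C is the field of
   complex numbers), an abstract C-vector space V equipped with an inner product
   that makes it a separable infinite-dimensional complex Hilbert space.
   (Possibly unbounded) linear operators are represented by their graphs. *)
From mathcomp Require Import all_boot all_algebra.
From mathcomp Require Import reals.
From mathcomp Require Import complex.
Set Implicit Arguments. Unset Strict Implicit. Unset Printing Implicit Defensive.
Import GRing.Theory Num.Theory.
Local Open Scope ring_scope.
Local Open Scope complex_scope.

Section Hilbert.
Variables (R : realType) (V : lmodType R[i]) (ip : V -> V -> R[i]).

(* squared norm ||x||^2 = (x,x) *)
Definition nsq (x : V) : R[i] := ip x x.

(* (.,.) is an inner product, linear in the first argument *)
Definition is_inner_product : Prop :=
  (forall (a : R[i]) (x y z : V), ip (a *: x + y) z = a * ip x z + ip y z) /\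
  (forall x y : V, ip y x = (ip x y)^*) /\
  (forall x : V, 0 <= ip x x) /\
  (forall x : V, ip x x = 0 -> x = 0).

Definition converges (u : nat -> V) (x : V) : Prop :=
  forall e : R[i], 0 < e -> exists N, forall n, (N <= n)%N -> nsq (u n - x) < e.

Definition cauchy_seq (u : nat -> V) : Prop :=
  forall e : R[i], 0 < e -> exists N, forall m n, (N <= m)%N -> (N <= n)%N ->
    nsq (u m - u n) < e.

Definition dense (D : V -> Prop) : Prop :=
  forall (x : V) (e : R[i]), 0 < e -> exists y, D y /\ nsq (x - y) < e.

Definition lin_indep (n : nat) (v : 'I_n -> V) : Prop :=
  forall c : 'I_n -> R[i], \sum_(k < n) c k *: v k = 0 -> forall k, c k = 0.

(* complex, infinite-dimensional, separable Hilbert space *)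
Definition is_sep_inf_hilbert : Prop :=
  is_inner_product /\
  (forall u, cauchy_seq u -> exists x, converges u x) /\
  (exists d : nat -> V, dense (fun x => exists n, x = d n)) /\
  (forall n, exists v : 'I_n -> V, lin_indep v).

(* ---------- operators as graphs ---------- *)
Definition op := V -> V -> Prop.   (* T f g  <->  f \in dom T /\ T f = g *)

Definition is_op (T : op) : Prop :=
  T 0 0 /\
  (forall (a : R[i]) f g f' g', T f g -> T f' g' -> T (a *: f + f') (a *: g + g')) /\
  (forall g, T 0 g -> g = 0).

Definition dom (T : op) (f : V) : Prop := exists g, T f g.

(* product with natural domain: (S T) f = S (T f) *)
Definition comp (S T : op) : op := fun f h => exists g, T f g /\ S g h.

Definition op_eq (S T : op) : Prop := forall f g, S f g <-> T f g.

(* S is a restriction of T / T is an extension of S *)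
Definition op_sub (S T : op) : Prop := forall f g, S f g -> T f g.

Definition densely_defined (T : op) : Prop := dense (dom T).

Definition closed_op (T : op) : Prop :=
  forall (u w : nat -> V) f g, (forall n, T (u n) (w n)) ->
    converges u f -> converges w g -> T f g.

(* adjoint: T^* h = k  iff  (T f, h) = (f, k) for all f \in dom T *)
Definition adj (T : op) : op :=
  fun h k => forall f g, T f g -> ip g h = ip f k.

Definition symmetric_op (T : op) : Prop := densely_defined T /\ op_sub T (adj T).

Definition selfadjoint (T : op) : Prop := densely_defined T /\ op_eq T (adj T).

Definition nonneg (T : op) : Prop := forall f g, T f g -> 0 <= ip g f.

Definition bounded (T : op) : Prop :=
  exists M : R[i], forall f g, T f g -> nsq g <= M * nsq f.

(* 0 is a point of regular type: ||T f|| >= c ||f||, c > 0 (squared form) *)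
Definition regular_type0 (T : op) : Prop :=
  exists c : R[i], 0 < c /\ forall f g, T f g -> c * nsq f <= nsq g.

(* resolvent (T + aI)^{-1} as a graph: h |-> f with T f + a f = h *)
Definition resolvent (T : op) (a : R[i]) : op :=
  fun h f => exists g, T f g /\ g + a *: f = h.

(* (S + aI)^{-1} <= (T + aI)^{-1} in the sense of quadratic forms *)
Definition res_le (S T : op) (a : R[i]) : Prop :=
  forall h f1 f2, resolvent S a h f1 -> resolvent T a h f2 -> ip f1 h <= ip f2 h.

Definition nonneg_sa_ext (A C : op) : Prop :=
  is_op C /\ selfadjoint C /\ nonneg C /\ op_sub A C.

(* Friedrichs extension: the maximal non-negative self-adjoint extension *)
Definition is_friedrichs (A F : op) : Prop :=
  nonneg_sa_ext A F /\
  forall C, nonneg_sa_ext A C -> forall a : R[i], 0 < a -> res_le F C a.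

(* Krein extension: the minimal non-negative self-adjoint extension *)
Definition is_krein (A K : op) : Prop :=
  nonneg_sa_ext A K /\
  forall C, nonneg_sa_ext A C -> forall a : R[i], 0 < a -> res_le C K a.

(* the conclusions of the theorem for a pair (B1, B2) of restrictions of B *)
Definition good_pair (B B1 B2 : op) : Prop :=
  (* closed densely defined restrictions *)
  is_op B1 /\ closed_op B1 /\ densely_defined B1 /\ op_sub B1 B /\
  is_op B2 /\ closed_op B2 /\ densely_defined B2 /\ op_sub B2 B /\
  (* (1) *)
  (forall f, dom B1 f -> dom B2 f -> f = 0) /\
  (* (2) *)
  (forall f, dom B f <-> exists f1 f2, dom B1 f1 /\ dom B2 f2 /\ f = f1 + f2) /\
  (* (3) *)
  (forall f, dom B1 f -> dom (comp (adj B) B) f -> f = 0) /\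
  (forall f, dom B2 f -> dom (comp (adj B) B) f -> f = 0) /\
  (* (4) *)
  (forall f, dom (comp (adj B) B1) f -> f = 0) /\
  (forall f, dom (comp (adj B) B2) f -> f = 0) /\
  (forall f, dom (comp B1 B1) f -> f = 0) /\
  (forall f, dom (comp B2 B2) f -> f = 0) /\
  (regular_type0 B ->
     (* (5)-(7), (9) for j = 1, 2 *)
     (forall Bj, (Bj = B1 \/ Bj = B2) ->
        densely_defined (comp Bj (adj B)) /\ nonneg (comp Bj (adj B)) /\
        symmetric_op (comp Bj (adj B)) /\
        is_friedrichs (comp Bj (adj B)) (comp B (adj B)) /\
        op_eq (adj (comp Bj (adj B))) (comp B (adj Bj)) /\
        is_krein (comp Bj (adj B)) (comp Bj (adj Bj))) /\
     (* (8) *)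
     (forall h, (dom (comp B1 (adj B)) h /\ dom (comp B2 (adj B)) h) <-> adj B h 0) /\
     (forall h, dom (comp B (adj B)) h <->
        exists h1 h2, dom (comp B1 (adj B)) h1 /\ dom (comp B2 (adj B)) h2 /\
                      h = h1 + h2)).

Definition op_pair_eq (P Q : op * op) : Prop := op_eq P.1 Q.1 /\ op_eq P.2 Q.2.

End Hilbert.

(* Main.v *)
Require Import Defs.
From mathcomp Require Import all_boot all_order all_algebra.
From mathcomp Require Import boolp classical_sets reals complex ring lra.
Import Defs.
Set Implicit Arguments. Unset Strict Implicit. Unset Printing Implicit Defensive.
Import Order.TTheory GRing.Theory Num.Theory.
Local Open Scope ring_scope.
Local Open Scope complex_scope.
Local Notation Re := (@complex.Re _).

(* The graph G of B is a Hilbert space. For a closed subspace M of G, the points of M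
   over dom (B^* B) are the points whose inner product with G is continuous in the norm
   of the first component, so M meets dom (B^* B) trivially as soon as the orthogonal
   complement of M in G projects onto a dense subspace. Hence (1)-(4) amount to an
   orthogonal decomposition of G into two closed subspaces that both project densely.
   It is built by choosing inductively two mutually orthogonal sequences in G whose
   first components approximate a dense sequence. An inductive step succeeds because
   the orthogonal complement of finitely many vectors whose span avoids dom (B^* B)
   projects densely, and because dom (B^* B) has infinite codimension in G, which is a
   gliding hump argument from the unboundedness of B. Starting the induction from
   different pairs of vectors gives different decompositions.

   When 0 is of regular type, B^* is onto and the range of B is the orthogonal
   complement of ker B^*. This gives (5), (7), (8), shows that the domain of B_j B^*
   is a core of B^* (whence the Friedrichs extension), and bounds the form of
   B_j B_j^* by that of any non-negative self-adjoint extension (whence the Krein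
   extension). *)

(** * Scalars: small quantities and passage to the limit in inequalities *)

Lemma inv_succ_lt (R : realType) (e : R) : 0 < e ->
  exists N, forall n, (N <= n)%N -> n.+1%:R^-1 < e.
Proof.
move=> e0; exists (Num.bound e^-1) => n Nn.
have h : e^-1 < n.+1%:R.
  apply: (lt_le_trans (archi_boundP _)); first by rewrite invr_ge0 ltW.
  by rewrite ler_nat (leq_trans Nn).
by rewrite invf_plt ?posrE.
Qed.

Lemma exists_small_scale (R : realType) (K e : R) : 0 <= K -> 0 < e ->
  exists t : R, 0 < t /\ t ^+ 2 * K < e.
Proof.
move=> K0 e0; exists (Num.sqrt (e / (K + 1))).
have h : 0 < e / (K + 1) by rewrite divr_gt0 // ltr_wpDl.
rewrite sqrtr_gt0 h sqr_sqrtr ?ltW //; split=> //.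
rewrite mulrAC ltr_pdivrMr; last by rewrite ltr_wpDl.
by rewrite ltr_pM2l // ltrDl.
Qed.

Lemma le_of_forall_lt (R : realType) (a b K : R) :
  (forall e, 0 < e -> a <= b + K * e) -> a <= b.
Proof.
move=> h; rewrite leNgt; apply/negP => ba.
have K0 : 0 < `|K| + 1 by rewrite ltr_wpDl.
have e0 : 0 < (a - b) / 2 / (`|K| + 1).
  by rewrite !divr_gt0 ?subr_gt0.
have := h _ e0; have : K * ((a - b) / 2 / (`|K| + 1)) <= (a - b) / 2.
  rewrite mulrCA ler_piMr ?divr_ge0 ?subr_ge0 ?ltW //.
  rewrite ltr_pdivrMr // mul1r; have := ler_norm K; lra.
lra.
Qed.

(** Multiplication by ['i] moves the imaginary part, up to sign, into the real part, so complex
    identities reduce to real ones. *)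
Lemma complex_ext (R : realType) (x y : R[i]) :
  Re x = Re y -> Re ('i * x) = Re ('i * y) -> x = y.
Proof.
case: x y => [a b] [c d] /= -> h; congr Complex.
by move: h; rewrite !mul0r !mul1r => h; lra.
Qed.

(** * Inner products, closures and orthogonal complements *)

Section InnerProduct.
Variables (R : realType) (U : lmodType R[i]) (ip : U -> U -> R[i]).
Hypothesis Hip : is_inner_product ip.

Definition re_ip (x y : U) : R := Re (ip x y).
Definition sqnorm (x : U) : R := re_ip x x.

Lemma ipDl x y z : ip (x + y) z = ip x z + ip y z.
Proof. by have [h _] := Hip; have := h 1 x y z; rewrite scale1r mul1r. Qed.

Lemma ip0l z : ip 0 z = 0.
Proof. by apply: (addrI (ip 0 z)); rewrite -ipDl !addr0. Qed.

Lemma ipZl a x z : ip (a *: x) z = a * ip x z.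
Proof. by have [h _] := Hip; have := h a x 0 z; rewrite ip0l !addr0. Qed.

Lemma ip_sym x y : ip y x = (ip x y)^*.
Proof. by have [_ [h _]] := Hip. Qed.

Lemma ipNl x z : ip (- x) z = - ip x z.
Proof. by rewrite -scaleN1r ipZl mulN1r. Qed.

Lemma ipDr x y z : ip z (x + y) = ip z x + ip z y.
Proof. by rewrite ip_sym ipDl rmorphD /= -!ip_sym. Qed.

Lemma ip0r z : ip z 0 = 0.
Proof. by rewrite ip_sym ip0l rmorph0. Qed.

Lemma ipZr a x z : ip z (a *: x) = conjc a * ip z x.
Proof. by rewrite ip_sym ipZl rmorphM /= -ip_sym. Qed.

Lemma ipNr x z : ip z (- x) = - ip z x.
Proof. by rewrite ip_sym ipNl rmorphN /= -ip_sym. Qed.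

Lemma ip_eq0_sym x y : ip x y = 0 -> ip y x = 0.
Proof. by rewrite (ip_sym x y) => ->; rewrite rmorph0. Qed.

Lemma ipxx x : ip x x = (sqnorm x)%:C.
Proof.
by have [_ [_ [/(_ x) h _]]] := Hip; rewrite /sqnorm /re_ip RRe_real // ger0_real.
Qed.

Lemma sqn_ge0 x : 0 <= sqnorm x.
Proof. by have [_ [_ [/(_ x) h _]]] := Hip; rewrite -ler0c -ipxx. Qed.

Lemma sqn_eq0 x : sqnorm x = 0 -> x = 0.
Proof. by have [_ [_ [_ h]]] := Hip; move=> q0; apply: h; rewrite ipxx q0. Qed.

Lemma sqn_gt0 x : x <> 0 -> 0 < sqnorm x.
Proof. by move=> x0; rewrite lt0r sqn_ge0 andbT; apply/eqP => /sqn_eq0. Qed.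

Lemma rip_sym x y : re_ip y x = re_ip x y.
Proof. by rewrite /re_ip ip_sym; case: (ip x y). Qed.

Lemma ripDl x y z : re_ip (x + y) z = re_ip x z + re_ip y z.
Proof. by rewrite /re_ip ipDl raddfD. Qed.
Lemma ripDr x y z : re_ip z (x + y) = re_ip z x + re_ip z y.
Proof. by rewrite /re_ip ipDr raddfD. Qed.
Lemma ripNl x z : re_ip (- x) z = - re_ip x z.
Proof. by rewrite /re_ip ipNl raddfN. Qed.
Lemma ripNr x z : re_ip z (- x) = - re_ip z x.
Proof. by rewrite /re_ip ipNr raddfN. Qed.
Lemma ripZl (a : R) x z : re_ip (a%:C *: x) z = a * re_ip x z.
Proof. by rewrite /re_ip ipZl; case: (ip x z) => b c /=; rewrite mul0r subr0. Qed.
Lemma ripZr (a : R) x z : re_ip z (a%:C *: x) = a * re_ip z x.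
Proof. by rewrite rip_sym ripZl rip_sym. Qed.

Definition ripE := (ripDl, ripDr, ripNl, ripNr, ripZl, ripZr).

Lemma sqnD x y : sqnorm (x + y) = sqnorm x + 2 * re_ip x y + sqnorm y.
Proof. by rewrite /sqnorm !ripE (rip_sym x y); ring. Qed.
Lemma sqnB x y : sqnorm (x - y) = sqnorm x - 2 * re_ip x y + sqnorm y.
Proof. by rewrite /sqnorm !ripE (rip_sym x y); ring. Qed.
Lemma sqnN x : sqnorm (- x) = sqnorm x.
Proof. by rewrite /sqnorm !ripE opprK. Qed.
Lemma sqn0 : sqnorm 0 = 0.
Proof. by rewrite /sqnorm /re_ip ip0l. Qed.
Lemma sqnZr (a : R) x : sqnorm (a%:C *: x) = a ^+ 2 * sqnorm x.
Proof. by rewrite /sqnorm !ripE mulrA. Qed.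
Lemma sqnZ (a : R[i]) x : sqnorm (a *: x) = Re (a * conjc a) * sqnorm x.
Proof.
rewrite /sqnorm /re_ip ipZl ipZr ipxx mulrA; case: a => a b /=; ring.
Qed.

Lemma sqnBC x y : sqnorm (x - y) = sqnorm (y - x).
Proof. by rewrite -sqnN opprB. Qed.

Lemma sqnD_le x y : sqnorm (x + y) <= 2 * sqnorm x + 2 * sqnorm y.
Proof. by have := sqn_ge0 (x - y); rewrite sqnB sqnD; lra. Qed.

Lemma sqn_triangle y x z : sqnorm (x - z) <= 2 * sqnorm (x - y) + 2 * sqnorm (y - z).
Proof.
have -> : x - z = (x - y) + (y - z) by rewrite addrA subrK.
exact: sqnD_le.
Qed.

Lemma cauchy_schwarz x y : re_ip x y ^+ 2 <= sqnorm x * sqnorm y.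
Proof.
have [->|/eqP y0] := eqVneq y 0; first by rewrite sqn0 /re_ip ip0r expr0n mulr0.
have y1 := sqn_gt0 y0.
have := sqn_ge0 ((sqnorm y)%:C *: x - (re_ip x y)%:C *: y).
rewrite sqnB !sqnZr !ripE; set a := re_ip x y; set b := sqnorm y; set c := sqnorm x.
have -> : b ^+ 2 * c - 2 * (b * (a * a)) + a ^+ 2 * b = b * (c * b - a ^+ 2) by ring.
by rewrite pmulr_rge0 // subr_ge0.
Qed.

Lemma ip_ext x y z w : re_ip x y = re_ip z w -> re_ip ('i *: x) y = re_ip ('i *: z) w ->
  ip x y = ip z w.
Proof. by rewrite /re_ip !ipZl; exact: complex_ext. Qed.

Definition adh (P : U -> Prop) (x : U) : Prop :=
  forall e : R, 0 < e -> exists y, P y /\ sqnorm (x - y) < e.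

Definition subspace (P : U -> Prop) : Prop :=
  P 0 /\ forall (a : R[i]) x y, P x -> P y -> P (a *: x + y).

Definition closed_set (P : U -> Prop) : Prop := forall x, adh P x -> P x.

Definition orth (P : U -> Prop) (x : U) : Prop := forall y, P y -> ip y x = 0.

Lemma subspaceD P x y : subspace P -> P x -> P y -> P (x + y).
Proof. by move=> [_ h] Px Py; have := h 1 _ _ Px Py; rewrite scale1r. Qed.

Lemma subspaceZ P a x : subspace P -> P x -> P (a *: x).
Proof. by move=> [h0 h] Px; have := h a _ _ Px h0; rewrite addr0. Qed.

Lemma subspaceN P x : subspace P -> P x -> P (- x).
Proof. by move=> h Px; rewrite -scaleN1r; exact: subspaceZ. Qed.

Lemma subspaceB P x y : subspace P -> P x -> P y -> P (x - y).
Proof. by move=> h Px Py; apply: subspaceD => //; exact: subspaceN. Qed.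

Lemma subspace_orth P : subspace (orth P).
Proof.
split=> [y _|a x y hx hy z Pz]; first exact: ip0r.
by rewrite ipDr ipZr hx // hy // mulr0 addr0.
Qed.

Lemma subspaceI P Q : subspace P -> subspace Q -> subspace (fun x => P x /\ Q x).
Proof. by move=> [p0 p] [q0 q]; split=> // a x y [Px Qx] [Py Qy]; split; auto. Qed.

Lemma closed_setI P Q : closed_set P -> closed_set Q -> closed_set (fun x => P x /\ Q x).
Proof.
move=> hP hQ x h; split; [apply: hP|apply: hQ] => e /h [y [[Py Qy] hy]]; by exists y.
Qed.

Lemma rip_adh P x y : adh P x -> (forall z, P z -> re_ip z y = 0) -> re_ip x y = 0.
Proof.
move=> hx hy.
have h : re_ip x y ^+ 2 <= 0.
  apply: (@le_of_forall_lt _ _ _ (sqnorm y)) => e /hx [z [Pz /ltW hz]].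
  have := cauchy_schwarz (x - z) y; rewrite ripDl ripNl (hy z Pz) oppr0 addr0 add0r.
  by move=> /le_trans; apply; rewrite mulrC ler_wpM2l ?sqn_ge0.
by apply/eqP; rewrite -sqrf_eq0 eq_le h sqr_ge0.
Qed.

(** The real version [rip_adh] is applied to [x] and to ['i *: x]; the latter is again adherent to
    [P] because [P] is stable under ['i]. *)
Lemma orth_adh P x y : subspace P -> adh P x -> orth P y -> ip x y = 0.
Proof.
move=> sP hx hy; rewrite -(ip0l 0); apply: ip_ext.
  by rewrite {2}/re_ip ip0l; apply: rip_adh hx _ => z /hy; rewrite /re_ip => ->.
rewrite scaler0 {2}/re_ip ip0l; apply: (@rip_adh P) => [e e0|z /hy]; last first.
  by rewrite /re_ip => ->.
have [z [Pz hz]] := hx e e0; exists ('i *: z); split; first exact: subspaceZ.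
by rewrite -scalerBr sqnZ /= mul0r mul1r opprK add0r mul1r.
Qed.

Lemma closed_orth P : closed_set (orth P).
Proof.
move=> x hx y Py; apply: ip_eq0_sym.
apply: orth_adh (subspace_orth P) hx _ => z /(_ y Py) h; exact: ip_eq0_sym.
Qed.

End InnerProduct.

Lemma posc_realE (R : realType) (e : R[i]) : 0 < e -> e = (Re e)%:C /\ 0 < Re e.
Proof. by case: e => a b; rewrite ltcE /= => /andP[/eqP -> h]. Qed.

(** * Completeness, Riesz representation and projections *)

Section Completeness.
Variables (R : realType) (U : lmodType R[i]) (ip : U -> U -> R[i]).
Hypothesis Hip : is_inner_product ip.
Local Notation rip := (re_ip ip).
Local Notation sqn := (sqnorm ip).
Local Notation adh := (adh ip).
Local Notation orth := (orth ip).

Lemma nsq_lt (x : U) (e : R) : (nsq ip x < e%:C) = (sqn x < e).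
Proof. by rewrite /nsq ipxx // ltcR. Qed.

Lemma convergesP (u : nat -> U) x : converges ip u x <->
  forall e : R, 0 < e -> exists N, forall n, (N <= n)%N -> sqn (u n - x) < e.
Proof.
split=> h e e0.
  have /h [N hN] : 0 < e%:C by rewrite ltcR.
  by exists N => n /hN; rewrite nsq_lt.
have [-> /h [N hN]] := posc_realE e0.
by exists N => n /hN; rewrite nsq_lt.
Qed.

Lemma cauchy_seqP (u : nat -> U) : cauchy_seq ip u <->
  forall e : R, 0 < e -> exists N, forall m n, (N <= m)%N -> (N <= n)%N ->
    sqn (u m - u n) < e.
Proof.
split=> h e e0.
  have /h [N hN] : 0 < e%:C by rewrite ltcR.
  by exists N => m n Nm Nn; rewrite -nsq_lt hN.
have [-> /h [N hN]] := posc_realE e0.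
by exists N => m n Nm Nn; rewrite nsq_lt hN.
Qed.

Lemma denseP (D : U -> Prop) : dense ip D <-> forall x, adh D x.
Proof.
split=> h x e e0.
  have /(h x) [y [Dy hy]] : 0 < e%:C by rewrite ltcR.
  by exists y; rewrite -nsq_lt.
have [-> /(h x) [y [Dy hy]]] := posc_realE e0.
by exists y; rewrite nsq_lt.
Qed.

Lemma adh_converges (P : U -> Prop) x :
  adh P x <-> exists u, (forall n, P (u n)) /\ converges ip u x.
Proof.
split=> [h|[u [Pu /convergesP h]] e /h [N hN]]; last first.
  by exists (u N); split=> //; rewrite sqnBC // hN.
have /choice[u hu] (n : nat) : exists y, P y /\ sqn (x - y) < n.+1%:R^-1.
  by apply: h; rewrite invr_gt0.
exists u; split=> [n|]; first by have [] := hu n.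
apply/convergesP => e /inv_succ_lt [N hN]; exists N => n /hN.
by apply: lt_trans; rewrite sqnBC //; have [] := hu n.
Qed.

Lemma orth_dense0 (D : U -> Prop) h : dense ip D -> orth D h -> h = 0.
Proof.
move=> /denseP/(_ h) dD hD; apply: (sqn_eq0 Hip).
by apply: (rip_adh Hip dD) => z /hD; rewrite /re_ip => ->.
Qed.

Hypothesis Hcomplete : forall u, cauchy_seq ip u -> exists x, converges ip u x.

(** [A d x] reads: [x] solves a problem up to error [d]. The estimate makes solutions with errors
    tending to 0 a Cauchy sequence, whose limit is approached by solutions of arbitrarily small
    error. *)
Lemma limit_of_approximants (A : R -> U -> Prop) (K : R) :
  (forall d, 0 < d -> exists x, A d x) ->
  (forall d d' x y, A d x -> A d' y -> sqn (x - y) <= K * (d + d')) ->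
  exists w, forall e, 0 < e -> exists d x, [/\ 0 < d, d < e, A d x & sqn (w - x) < e].
Proof.
move=> ex hA.
have /choice[u hu] (n : nat) : exists y, A n.+1%:R^-1 y.
  by apply: ex; rewrite invr_gt0.
have K0 : 0 < `|K| + 1 by rewrite ltr_wpDl.
have [|w /convergesP hw] := Hcomplete (u := u).
  apply/cauchy_seqP => e e0.
  have /inv_succ_lt [N hN] : 0 < e / 2 / (`|K| + 1) by rewrite !divr_gt0.
  exists N => m n /hN hm /hN hn; apply: le_lt_trans (hA _ _ _ _ (hu m) (hu n)) _.
  have d0 : 0 < m.+1%:R^-1 + n.+1%:R^-1 :> R by rewrite addr_gt0 ?invr_gt0.
  apply: (@le_lt_trans _ _ ((`|K| + 1) * (m.+1%:R^-1 + n.+1%:R^-1))).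
    by rewrite ler_pM2r //; have := ler_norm K; lra.
  rewrite mulrC -ltr_pdivlMr //.
  have -> : e / (`|K| + 1) = e / 2 / (`|K| + 1) + e / 2 / (`|K| + 1) by field; lra.
  exact: ltrD.
exists w => e e0; have [N hN] := hw e e0; have [N' hN'] := inv_succ_lt e0.
exists (maxn N N').+1%:R^-1, (u (maxn N N')); split.
- by rewrite invr_gt0.
- by rewrite hN' // leq_maxr.
- exact: hu.
- by rewrite sqnBC // hN // leq_maxl.
Qed.

(* The representing vector maximises [2 Re l(v) - |v|^2]; the linear form [l] is
   given by its graph [P], so that this single statement yields both orthogonal
   projections and bounded forms on non-closed subspaces. *)
Lemma riesz (P : U -> R[i] -> Prop) (C : R) : P 0 0 ->
  (forall a v r v' r', P v r -> P v' r' -> P (a *: v + v') (a * r + r')) ->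
  (forall v r, P v r -> 2 * Re r - sqn v <= C) ->
  exists w, [/\ adh (fun v => exists r, P v r) w,
                forall v r, P v r -> r = ip v w & sqn w <= C].
Proof.
move=> P0 Plin PC.
pose S := [set x : R | exists v r, P v r /\ x = 2 * Re r - sqn v]%classic.
have Sub : has_ubound S by exists C => _ [v [r [Pvr ->]]]; exact: PC.
have Ssup : has_sup S by split=> //; exists (2 * Re 0 - sqn 0); exists 0, 0.
have les v r : P v r -> 2 * Re r - sqn v <= sup S.
  by move=> Pvr; apply: ub_le_sup => //; exists v, r.
pose A d v := exists r, P v r /\ sup S - d < 2 * Re r - sqn v.
have [d d0|d d' v v' [r [Pv hv]] [r' [Pv' hv']]|w hw] :=
    @limit_of_approximants A 2.
- have [_ [v [r [Pvr ->]]] h] := sup_adherent d0 Ssup.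
  by exists v, r.
(* Parallelogram law: the value at the midpoint of [v] and [v'] is at most the supremum, which
   bounds the squared distance of [v] and [v'] by [2 * (d + d')]. *)
- have := les _ _ (Plin (2^-1)%:C _ _ _ _ (Plin 1 _ _ _ _ Pv Pv') P0).
  rewrite !addr0 scale1r mul1r sqnZr //.
  have -> : Re ((2^-1)%:C * (r + r')) = (Re r + Re r') / 2.
    by case: (r) (r') => a b [c d1] /=; field.
  by rewrite expr2 (sqnD _ v v') // sqnB //; lra.
have wP v r : P v r -> Re r = rip v w.
  move=> Pvr; have v0 := sqn_ge0 Hip v; apply/eqP; rewrite -subr_eq0.
  (* A linear term bounded by a quadratic one for all real [t] vanishes: test at [x / (sqn v + 1)],
     where the [+ 1] keeps the denominator positive. *)
  suff h t : t * (Re r - rip v w) <= t ^+ 2 * sqn v.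
    have := h ((Re r - rip v w) / (sqn v + 1)); move: (Re r - rip v w) => x.
    have K0 : 0 < sqn v + 1 by rewrite ltr_wpDl.
    have -> : (x / (sqn v + 1)) ^+ 2 * sqn v =
              x / (sqn v + 1) * x - (x / (sqn v + 1)) ^+ 2.
      by field; rewrite gt_eqF.
    rewrite -subr_ge0 addrAC subrr add0r oppr_ge0 => hx.
    have : (x / (sqn v + 1)) ^+ 2 == 0 by rewrite eq_le hx sqr_ge0.
    by rewrite sqrf_eq0 mulf_eq0 invr_eq0 (gt_eqF K0) orbF.
  (* The supremum bounds the value at [t v + v'], with [v'] an almost maximiser close to [w]; the
     errors vanish with [e]. *)
  have : 2 * (t * (Re r - rip v w)) <= 2 * (t ^+ 2 * sqn v); last by lra.
  apply: (@le_of_forall_lt _ _ _ 2) => e /hw [d [v' [d0 de [r' [Pv' hv']] hwv]]].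
  have := les _ _ (Plin t%:C _ _ _ _ Pvr Pv').
  have -> : Re (t%:C * r + r') = t * Re r + Re r'.
    by case: (r) (r') => a b [c d1] /=; ring.
  rewrite sqnD // sqnZr // ripZl //.
  have := sqn_ge0 Hip (w - v' + t%:C *: v).
  rewrite (sqnD _ (w - v')) // sqnZr // ripZr // ripDl // ripNl // (rip_sym _ v') //.
  by rewrite (rip_sym _ v w) //; lra.
exists w; split=> [e /hw [d [v [_ _ [r [Pvr _]] h]]]|v r Pvr|].
- by exists v; split=> //; exists r.
- apply: complex_ext; first exact: wP.
  rewrite -(ipZl Hip); apply: wP.
  by have := Plin 'i _ _ _ _ Pvr P0; rewrite !addr0.
- apply: (@le_of_forall_lt _ _ _ 1) => e /hw [d [v [_ _ [r [Pvr _]] h]]].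
  have := PC _ _ Pvr; rewrite (wP _ _ Pvr); move: h; rewrite sqnB // (rip_sym _ v) //.
  lra.
Qed.

(** [riesz] for the form [ip v x] on [M]. As [M] may fail to be closed, the foot is only placed in
    its closure. *)
Lemma projection (M : U -> Prop) x : subspace M ->
  exists w, adh M w /\ orth M (x - w).
Proof.
move=> [M0 Mlin].
have [|a v r v' r' [Mv ->] [Mv' ->]|v r [Mv ->]|w [hw hr _]] :=
    @riesz (fun v r => M v /\ r = ip v x) (sqn x).
- by rewrite ip0l.
- by split; [exact: Mlin|rewrite ipDl // ipZl].
- by have := sqn_ge0 Hip (v - x); rewrite sqnB // /re_ip; lra.
exists w; split=> [e /hw [y [[r [My _]] hy]]|y My]; first by exists y.
by rewrite ipDr // ipNr // -(hr _ _ (conj My erefl)) subrr.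
Qed.

Lemma dense_of_orth0 (M : U -> Prop) : subspace M ->
  (forall h, orth M h -> h = 0) -> dense ip M.
Proof.
move=> sM h; apply/denseP => x; have [w [Mw /h/eqP]] := projection x sM.
by rewrite subr_eq0 => /eqP ->.
Qed.

End Completeness.

(** * The Hilbert space of pairs and the graphs of operators *)

Section Product.
Variables (R : realType) (V : lmodType R[i]) (ip : V -> V -> R[i]).
Hypothesis Hip : is_inner_product ip.

Definition graph_ip (x y : V * V) : R[i] := ip x.1 y.1 + ip x.2 y.2.

Lemma sqn2E x : sqnorm graph_ip x = sqnorm ip x.1 + sqnorm ip x.2.
Proof. by rewrite /sqnorm /re_ip raddfD. Qed.

Lemma ip2_inner_product : is_inner_product graph_ip.
Proof.
have [lin [sym [pos def]]] := Hip; split; [|split; [|split]].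
- by move=> a x y z; rewrite /graph_ip /= !lin; ring.
- by move=> x y; rewrite /graph_ip /= rmorphD /= -!sym.
- by move=> x; rewrite addr_ge0.
move=> [x y] /eqP; rewrite /graph_ip paddr_eq0 //= => /andP[/eqP/def -> /eqP/def ->].
by [].
Qed.

Lemma ip2_complete : (forall u, cauchy_seq ip u -> exists x, converges ip u x) ->
  forall u, cauchy_seq graph_ip u -> exists x, converges graph_ip u x.
Proof.
move=> hc u /(cauchy_seqP ip2_inner_product) hu.
have sqn0 := sqn_ge0 Hip.
have [|x /(convergesP Hip) hx] := hc (fun n => (u n).1).
  apply/(cauchy_seqP Hip) => e /hu [N hN]; exists N => m n hm hn.
  by apply: le_lt_trans (hN _ _ hm hn); rewrite sqn2E /= lerDl.
have [|y /(convergesP Hip) hy] := hc (fun n => (u n).2).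
  apply/(cauchy_seqP Hip) => e /hu [N hN]; exists N => m n hm hn.
  by apply: le_lt_trans (hN _ _ hm hn); rewrite sqn2E /= lerDr.
exists (x, y); apply/(convergesP ip2_inner_product) => e e0.
have e20 : 0 < e / 2 by rewrite divr_gt0.
have [N hN] := hx _ e20; have [M hM] := hy _ e20; exists (maxn N M) => n.
rewrite geq_max => /andP[/hN h1 /hM h2]; rewrite sqn2E /=; lra.
Qed.

Definition graph (T : op V) (p : V * V) : Prop := T p.1 p.2.

Lemma subspace_graph (T : op V) : is_op T -> subspace (graph T).
Proof. by move=> [T0 [Tlin _]]; split=> // a x y; exact: Tlin. Qed.

Lemma closed_graphP (T : op V) : closed_op ip T <-> closed_set graph_ip (graph T).
Proof.
have h2 := ip2_inner_product; have sqn0 := sqn_ge0 Hip.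
split=> [cl [f g] /(adh_converges h2) [u [Tu /(convergesP h2) hu]]|cl u w f g Tuw hf hg].
  apply: (cl (fun n => (u n).1) (fun n => (u n).2)) => // [|].
    apply/(convergesP Hip) => e /hu [N hN]; exists N => n /hN.
    by apply: le_lt_trans; rewrite sqn2E /= lerDl.
  apply/(convergesP Hip) => e /hu [N hN]; exists N => n /hN.
  by apply: le_lt_trans; rewrite sqn2E /= lerDr.
apply: (cl (f, g)) => e e0; have e20 : 0 < e / 2 by rewrite divr_gt0.
move/(convergesP Hip): hf => /(_ _ e20) [N hN].
move/(convergesP Hip): hg => /(_ _ e20) [M hM].
exists (u (maxn N M), w (maxn N M)); split; first exact: Tuw.
rewrite sqn2E /=.
have := hN _ (leq_maxl N M); have := hM _ (leq_maxr N M).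
rewrite !(sqnBC Hip f) !(sqnBC Hip g); lra.
Qed.

End Product.

(** * Finite spans and projections onto them *)

Section FiniteSpan.
Variables (R : realType) (U : lmodType R[i]) (ip : U -> U -> R[i]).
Hypothesis Hip : is_inner_product ip.

Fixpoint span (s : seq U) (x : U) : Prop :=
  if s is y :: s' then exists c z, span s' z /\ x = c *: y + z else x = 0.

Definition in_seq (s : seq U) (x : U) : Prop := x \in s.

Lemma subspace_span s : subspace (span s).
Proof.
elim: s => [|y s [h0 h]] /=; first by split=> // a x z -> ->; rewrite scaler0 addr0.
split; first by exists 0, 0; rewrite scale0r addr0.
move=> a _ _ [c [z [sz ->]]] [c' [z' [sz' ->]]].
exists (a * c + c'), (a *: z + z'); split; first exact: h.
by rewrite scalerDr scalerDl scalerA addrACA.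
Qed.

Lemma span_subspace (P : U -> Prop) s : subspace P ->
  (forall x, x \in s -> P x) -> forall x, span s x -> P x.
Proof.
move=> [P0 Plin]; elim: s => [_ x -> //|y s IH] h x [c [z [sz ->]]].
apply: Plin; first by apply: h; rewrite mem_head.
by apply: IH sz => t ts; apply: h; rewrite in_cons ts orbT.
Qed.

Lemma span_cons s x : span (x :: s) x.
Proof. by exists 1, 0; rewrite scale1r addr0; split=> //; have [] := subspace_span s. Qed.

Lemma orth_span s x : orth ip (in_seq s) x -> orth ip (span s) x.
Proof.
move=> h y; apply: (@span_subspace (fun y => ip y x = 0)) => //; split.
  exact: ip0l.
by move=> a u v hu hv; rewrite ipDl // ipZl // hu hv mulr0 addr0.
Qed.

Lemma orth_in_seq_cons s x y :
  orth ip (in_seq (y :: s)) x <-> ip y x = 0 /\ orth ip (in_seq s) x.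
Proof.
split=> [h|[hy h] z]; last by rewrite /in_seq in_cons => /predU1P[->|/h].
split=> [|z zs]; first by apply: h; exact: mem_head.
by apply: h; rewrite /in_seq in_cons zs orbT.
Qed.

(** One Gram-Schmidt step per vector. Unlike that of [projection], the foot lies in the span
    itself. *)
Lemma span_projection s x : exists w, span s w /\ orth ip (in_seq s) (x - w).
Proof.
elim: s x => [|y s IH] x; first by exists 0; split.
have [wy [sy oy]] := IH y; have [wx [sx ox]] := IH x.
set y' := y - wy in oy; set x' := x - wx in ox.
have sp := subspace_span s; have spc := subspace_span (y :: s).
have inc z : span s z -> span (y :: s) z by exists 0, z; rewrite scale0r add0r.
have sy' : span (y :: s) y' by apply: (subspaceB spc); [exact: span_cons|exact: inc].
pose c := ip x' y' / ip y' y'.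
exists (wx + c *: y'); split.
  by apply: (subspaceD spc); [exact: inc|exact: (subspaceZ c spc)].
have ox2 : orth ip (in_seq s) (x - (wx + c *: y')).
  have so := subspace_orth Hip (in_seq s).
  by rewrite opprD addrA -/x'; apply: (subspaceB so) => //; exact: (subspaceZ c so).
apply/orth_in_seq_cons; split=> //.
have -> : y = y' + wy by rewrite subrK.
rewrite ipDl // (orth_span ox2 sy) addr0; apply: ip_eq0_sym => //.
rewrite opprD addrA -/x' ipDl // ipNl // ipZl // /c.
(* If [y] depends on [s], then [y'] is 0 and [c] is a quotient by 0; the orthogonality is then
   trivial. *)
have [y0|y0] := eqVneq (ip y' y') 0; last by rewrite divfK // subrr.
have -> : y' = 0 by have [_ [_ [_ def]]] := Hip; exact: def.
by rewrite !(ip0r Hip) mulr0 subrr.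
Qed.

End FiniteSpan.

(** * Unbounded functionals by a gliding hump *)

Section GlidingHump.
Variables (R : realType) (V : lmodType R[i]) (ip : V -> V -> R[i]).
Hypothesis Hip : is_inner_product ip.
Hypothesis Hcomplete : forall u, cauchy_seq ip u -> exists x, converges ip u x.
Local Notation ip2 := (graph_ip ip).
Let Hip2 : is_inner_product ip2 := ip2_inner_product Hip.

(** The norm of a pair is not dominated by that of its first component; on the graph of an operator
    this is unboundedness of the operator. *)
Definition fst_unbounded (N : V * V -> Prop) : Prop :=
  forall M : R, exists x, N x /\ M * sqnorm ip x.1 < sqnorm ip2 x.

(** If the two norms were equivalent on the part of [N] orthogonal to [f], they would be equivalent
    on [N], which is larger by at most one dimension. *)
Lemma fst_unbounded_orth1 (N : V * V -> Prop) f :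
  subspace N -> closed_set ip2 N -> (forall x, N x -> x.1 = 0 -> x = 0) ->
  fst_unbounded N -> fst_unbounded (fun x => N x /\ ip2 f x = 0).
Proof.
move=> sN cN iN UN; apply: contrapT => /existsNP [M nM].
have bM x : N x -> ip2 f x = 0 -> sqnorm ip2 x <= M * sqnorm ip x.1.
  move=> Nx fx; rewrite leNgt; apply/negP => h; apply: nM; by exists x.
have [[z [Nz fz]]|nz] := pselect (exists z, N z /\ ip2 f z <> 0); last first.
  have [x [Nx hx]] := UN M; have := bM x Nx; rewrite leNgt hx /=.
  have [->|/eqP fx] := eqVneq (ip2 f x) 0; first by move=> /(_ erefl).
  by case: nz; exists x.
(* [z] has positive distance to [N /\ f^perp] in the weaker norm, since the two norms
   are equivalent on the latter *)
have [dl [dl0 hdl]] : exists dl : R, 0 < dl /\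
    forall x, N x -> ip2 f x = 0 -> dl <= sqnorm ip (x + z).1.
  apply: contrapT => nd; pose A (d : R) x := [/\ N x, ip2 f x = 0 & sqnorm ip (x + z).1 < d].
  have Kge : 0 <= `|M| by exact: normr_ge0.
  have [d d0|d d' x y [Nx fx hx] [Ny fy hy]|w hw] :=
      @limit_of_approximants _ _ _ Hip2 (ip2_complete Hip Hcomplete) A (2 * `|M|).
  - apply: contrapT => ne; apply: nd; exists d; split=> // x Nx fx.
    by rewrite leNgt; apply/negP => h; apply: ne; exists x.
  - have fxy : ip2 f (x - y) = 0 by rewrite ipDr // ipNr // fx fy subrr.
    apply: le_trans (bM _ (subspaceB sN Nx Ny) fxy) _.
    apply: (@le_trans _ _ (`|M| * sqnorm ip (x - y).1)).
      by rewrite ler_wpM2r ?sqn_ge0 // ler_norm.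
    rewrite (mulrC 2) -mulrA ler_wpM2l //.
    have -> : (x - y).1 = (x + z).1 - (y + z).1 by rewrite /= opprD addrACA subrr addr0.
    apply: le_trans (sqnD_le Hip _ _) _; rewrite sqnN //; lra.
  (* The limit [w] cancels [z] in the first component, so injectivity of the first projection gives
     [w = - z]; but [f] is orthogonal to [w] and not to [z]. *)
  have Pw : N w /\ orth ip2 (eq f) w.
    apply: (closed_setI cN (closed_orth Hip2 (P := eq f))) => e /hw [d [x [_ _ [Nx fx _] h]]].
    by exists x; split=> //; split=> // _ <-.
  have wz0 : (w + z).1 = 0.
    apply: (sqn_eq0 Hip); apply/eqP; rewrite eq_le sqn_ge0 // andbT.
    apply: (@le_of_forall_lt _ _ _ 4) => e /hw [d [x [d0 de [Nx fx hx] h]]].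
    have -> : (w + z).1 = (w - x).1 + (x + z).1 by rewrite /= addrA subrK.
    apply: le_trans (sqnD_le Hip _ _) _.
    have : sqnorm ip (w - x).1 <= sqnorm ip2 (w - x) by rewrite sqn2E lerDl sqn_ge0.
    lra.
  have /eqP := iN _ (subspaceD sN Pw.1 Nz) wz0.
  rewrite addr_eq0 => /eqP wz; apply: fz.
  have -> : z = - w by rewrite wz opprK.
  by rewrite ipNr // (Pw.2 f) // oppr0.
have dl1 : dl <> 0 by apply/eqP; rewrite gt_eqF.
have s1 := sqn_ge0 Hip; have s2 := sqn_ge0 Hip2.
pose a := sqnorm ip2 z; pose b := sqnorm ip z.1.
(* Write [x = x' + c *: z] with [x'] orthogonal to [f]. Then [c2 * dl] is at most the squared norm
   of [x.1], and the bound on [x'] gives at most [4 * |M|] times that norm plus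
   [c2 * (4 * |M| * b + 2 * a)] for [x], against the choice of the constant. *)
have [x [Nx hx]] := UN (4 * `|M| + (4 * `|M| * b + 2 * a) / dl).
pose c := conjc (ip2 f x / ip2 f z); pose c2 := Re (c * conjc c).
pose x' := x - c *: z.
have Nx' : N x' by apply: subspaceB => //; exact: subspaceZ.
have fx' : ip2 f x' = 0.
  by rewrite ipDr // ipNr // ipZr // /c conjcK divfK ?subrr //; exact/eqP.
have c2dl : c2 * dl <= sqnorm ip x.1.
  have [c0|c0] := eqVneq c 0; first by rewrite /c2 c0 mul0r /= mul0r.
  have -> : x.1 = c *: (c^-1 *: x' + z).1.
    by rewrite /= scalerDr scalerA divff // scale1r subrK.
  rewrite sqnZ // ler_wpM2l //.
    by rewrite /c2; case: (c) => p q /=; have := sqr_ge0 p; have := sqr_ge0 q; lra.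
  by apply: hdl; [exact: subspaceZ|rewrite ipZr // fx' mulr0].
have c20 : 0 <= c2.
  by rewrite /c2; case: (c) => p q /=; have := sqr_ge0 p; have := sqr_ge0 q; lra.
have h1 : sqnorm ip2 x <= 2 * sqnorm ip2 x' + 2 * (c2 * a).
  by have := sqnD_le Hip2 x' (c *: z); rewrite subrK sqnZ.
have h2 : sqnorm ip x'.1 <= 2 * sqnorm ip x.1 + 2 * (c2 * b).
  by have := sqnD_le Hip x.1 (- (c *: z).1); rewrite sqnN // sqnZ.
have h3 : sqnorm ip2 x' <= `|M| * sqnorm ip x'.1.
  by apply: le_trans (bM _ Nx' fx') _; rewrite ler_wpM2r ?ler_norm.
have h4 : `|M| * sqnorm ip x'.1 <= `|M| * (2 * sqnorm ip x.1 + 2 * (c2 * b)).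
  by rewrite ler_wpM2l.
have h5 : c2 * (4 * `|M| * b + 2 * a) <= (4 * `|M| * b + 2 * a) / dl * sqnorm ip x.1.
  rewrite -[leRHS]mulrA (mulrC dl^-1) (mulrC c2) ler_wpM2l //; last by rewrite ler_pdivlMr.
  by rewrite addr_ge0 ?mulr_ge0 // /a /b.
move: hx; rewrite mulrDl ltNge => /negP; apply; apply: le_trans h1 _.
have -> : 4 * `|M| * sqnorm ip x.1 = 2 * (`|M| * (2 * sqnorm ip x.1)) by ring.
have : `|M| * (2 * sqnorm ip x.1 + 2 * (c2 * b)) =
    `|M| * (2 * sqnorm ip x.1) + `|M| * (2 * (c2 * b)) by rewrite mulrDr.
have : c2 * (4 * `|M| * b + 2 * a) = 2 * (`|M| * (2 * (c2 * b))) + 2 * (c2 * a) by ring.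
lra.
Qed.

Lemma fst_unbounded_orth (N : V * V -> Prop) s :
  subspace N -> closed_set ip2 N -> (forall x, N x -> x.1 = 0 -> x = 0) ->
  fst_unbounded N -> fst_unbounded (fun x => N x /\ orth ip2 (in_seq s) x).
Proof.
move=> sN cN iN UN; elim: s => [|f s IH] M.
  by have [x [Nx hx]] := UN M; exists x.
have [| | |x [[[Nx ox] fx] hx]] := @fst_unbounded_orth1 _ f _ _ _ IH M.
- by apply: subspaceI => //; exact: subspace_orth.
- by apply: closed_setI => //; exact: closed_orth.
- by move=> x [Nx _]; exact: iN.
by exists x; split=> //; split=> //; exact/orth_in_seq_cons.
Qed.

(* If the first component does not control the norm on [N], some functional
   [(y, .)] is unbounded for the seminorm of the first component: gliding hump along
   unit vectors [x n] with steps of length [4 ^- n], the sign of each step being chosen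
   so that the previous contributions cannot cancel it. *)
Lemma exists_unbounded_functional (N : V * V -> Prop) :
  subspace N -> closed_set ip2 N -> fst_unbounded N ->
  exists y, N y /\ forall C : R, exists x, N x /\ C * sqnorm ip x.1 < re_ip ip2 y x ^+ 2.
Proof.
move=> sN cN UN; have s1 := sqn_ge0 Hip; have s2 := sqn_ge0 Hip2.
(* The squared pairing of the limit with [x n] will be at least [16 ^- n / 4], while the squared
   first component is below [64 ^- n]: the quotient grows like [4 ^ n]. *)
have /choice[x hx] (n : nat) :
    exists x, [/\ N x, 64 ^+ n * sqnorm ip x.1 < 1 & sqnorm ip2 x = 1].
  have [x [Nx h]] := UN (64 ^+ n).
  have x0 : 0 < sqnorm ip2 x by apply: le_lt_trans h; rewrite mulr_ge0 ?exprn_ge0.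
  have k0 : 0 < Num.sqrt (sqnorm ip2 x) by rewrite sqrtr_gt0.
  exists ((Num.sqrt (sqnorm ip2 x))^-1%:C *: x); split; first exact: subspaceZ.
    by rewrite sqnZr // exprVn sqr_sqrtr ?ltW // mulrCA ltr_pdivrMl ?mulr1.
  by rewrite sqnZr // exprVn sqr_sqrtr ?ltW // mulVf // gt_eqF.
pose r n : R := 4 ^- n.
have r0 n : 0 < r n by rewrite /r invr_gt0 exprn_gt0.
have rS n : r n.+1 = r n / 4 by rewrite /r exprS invfM mulrC.
pose y := fix y n := if n is m.+1 then
  y m + (if 0 <= re_ip ip2 (y m) (x m) then r m else - r m)%:C *: x m else 0.
have ystep n : sqnorm ip2 (y n.+1 - y n) = r n ^+ 2.
  rewrite /= addrAC subrr add0r sqnZr //; have [_ _ ->] := hx n.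
  by case: ifP => _; rewrite ?sqrrN mulr1.
have yN n : N (y n).
  elim: n => [|n IH]; first by case: sN.
  by apply: (subspaceD sN) => //; apply: subspaceZ => //; have [] := hx n.
have ybig n : r n ^+ 2 <= re_ip ip2 (y n.+1) (x n) ^+ 2.
  rewrite /= ripDl // ripZl //; have [_ _ h] := hx n; rewrite -/(sqnorm ip2 (x n)) h mulr1.
  have := r0 n; case: (lerP 0 (re_ip ip2 (y n) (x n))) => h' h''.
    by rewrite ler_sqr ?nnegrE; lra.
  by rewrite -[leRHS]sqrrN ler_sqr ?nnegrE; lra.
(* The constant is the square of [1 + 1/4 + 1/16 + ... = 4/3]. The induction uses
   [|p + q|^2 <= 4 |p|^2 + 4/3 |q|^2], which is positivity of [|3 p - q|^2]. *)
have ytail k n : sqnorm ip2 (y (n + k)%N - y n) <= 16 / 9 * r n ^+ 2.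
  elim: k n => [|k IH] n; first by rewrite addn0 subrr sqn0 // mulr_ge0 ?sqr_ge0 //; lra.
  have := IH n.+1; rewrite addSnnS rS; set p := y (n + k.+1)%N - y n.+1.
  have -> : y (n + k.+1)%N - y n = p + (y n.+1 - y n) by rewrite /p addrA subrK.
  set q := y n.+1 - y n => h; have hq : sqnorm ip2 q = r n ^+ 2 by exact: ystep.
  clearbody p q; have := s2 ((3%:R)%:C *: p - q).
  rewrite sqnB // sqnD // sqnZr // ripZl // hq; move: h; rewrite expr_div_n; lra.
have rsmall e : 0 < e -> exists n, r n < e.
  move=> /inv_succ_lt [n hn]; exists n; apply: le_lt_trans (hn n (leqnn n)).
  by rewrite /r lef_pV2 ?posrE ?exprn_gt0 // -natrX ler_nat ltn_expl.
have r1 n : r n <= 1.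
  by rewrite /r invf_le1 ?exprn_gt0 // exprn_ege1 //; lra.
have r2 n : r n ^+ 2 <= r n by rewrite expr2 ler_piMr // ltW.
have [|w hw] := ip2_complete Hip Hcomplete (u := y).
  apply/cauchy_seqP => // e e0.
  have [n hn] : exists n, r n < e / 8 by apply: rsmall; rewrite divr_gt0.
  exists n => m m' /subnKC <- /subnKC <-.
  apply: le_lt_trans (sqn_triangle Hip2 (y n) _ _) _; rewrite (sqnBC Hip2 (y n)).
  have := ytail (m - n)%N n; have := ytail (m' - n)%N n; have := r2 n; lra.
have Nw : N w by apply: cN; apply/(adh_converges Hip2); exists y.
have wtail n : sqnorm ip2 (w - y n.+1) <= r n ^+ 2 / 4.
  suff : sqnorm ip2 (w - y n.+1) <= 2 / 9 * r n ^+ 2 by have := sqr_ge0 (r n); lra.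
  apply: (@le_of_forall_lt _ _ _ 2) => e.
  move/(convergesP Hip2): hw => h /h {h} [m hm].
  apply: le_trans (sqn_triangle Hip2 (y (n.+1 + m)%N) _ _) _.
  have := hm _ (leq_addl n.+1 m); rewrite (sqnBC Hip2 w).
  have := ytail m n.+1; rewrite rS expr_div_n; lra.
exists w; split=> // C.
have [n hn] : exists n, r n < (`|C| * 4 + 1)^-1.
  by apply: rsmall; rewrite invr_gt0 ltr_wpDl ?mulr_ge0.
have [Nx hx1 hx2] := hx n; exists (x n); split=> //.
(* Replacing [y n.+1] by the limit changes the pairing with [x n], of size at least [r n], by at
   most half of [r n]. *)
have big : r n ^+ 2 / 4 <= re_ip ip2 w (x n) ^+ 2.
  have := cauchy_schwarz Hip2 (w - y n.+1) (x n); rewrite hx2 mulr1.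
  have := ybig n; have := wtail n; rewrite ripDl // ripNl //.
  set q := re_ip ip2 (y n.+1) (x n); set p := re_ip ip2 w (x n) => h1 h2 h3.
  have : q ^+ 2 <= 2 * p ^+ 2 + 2 * (p - q) ^+ 2.
    by have := sqr_ge0 (2 * p - q); rewrite !expr2; lra.
  lra.
apply: lt_le_trans big.
have C4 : `|C| * 4 + 1 < 4 ^+ n.
  by move: hn; rewrite /r ltf_pV2 ?posrE ?exprn_gt0 // ltr_wpDl // mulr_ge0.
have e64 : 64 ^+ n = (4 ^+ n) ^+ 3 :> R by rewrite -exprM mulnC exprM; congr (_ ^+ _); ring.
have f0 : 0 < 4 ^+ n :> R by rewrite exprn_gt0.
rewrite /r exprVn; move: hx1 C4 f0; rewrite e64; move: (4 ^+ n) => t hx1 C4 f0.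
rewrite -(ltr_pM2l (exprn_gt0 3 f0)).
have -> : t ^+ 3 * (t ^- 2 / 4) = t / 4 by field; rewrite gt_eqF.
rewrite mulrCA; apply: (@le_lt_trans _ _ (`|C| * (t ^+ 3 * sqnorm ip (x n).1))).
  by rewrite ler_wpM2r ?ler_norm // mulr_ge0 // exprn_ge0 ?ltW.
have : `|C| * (t ^+ 3 * sqnorm ip (x n).1) <= `|C|.
  by rewrite ler_piMr // ltW.
lra.
Qed.
End GlidingHump.

(** * Orthogonal splittings of the graph of [B] *)

Section Splitting.
Variables (R : realType) (V : lmodType R[i]) (ip : V -> V -> R[i]) (B : op V).
Hypothesis Hip : is_inner_product ip.
Hypothesis Hcomplete : forall u, cauchy_seq ip u -> exists x, converges ip u x.
Hypotheses (Bop : is_op B) (Bclosed : closed_op ip B).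
Hypotheses (Bdense : densely_defined ip B) (Bunbounded : ~ bounded ip B).
Local Notation ip2 := (graph_ip ip).
Local Notation W := (V * V)%type.
Local Notation gB := (graph B).
Let Hip2 : is_inner_product ip2 := ip2_inner_product Hip.
Let sB : subspace gB := subspace_graph Bop.
Let cB : closed_set ip2 gB := (closed_graphP Hip B).1 Bclosed.

(* The graph of [B] over [dom (B^* B)]: those points of the graph whose graph inner
   product is continuous for the weaker norm of [V]. *)
Definition regular_point (p : W) : Prop :=
  gB p /\ exists h, forall x, gB x -> ip2 x p = ip x.1 h.

Lemma subspace_regular_point : subspace regular_point.
Proof.
split; first by split; [case: sB|exists 0 => x _; rewrite !ip0r].
move=> a x y [gx [h hx]] [gy [k hy]]; split; first by apply sB.
exists (a *: h + k) => z gz.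
by rewrite !(ipDr Hip) !(ipDr Hip2) (ipZr Hip2) (ipZr Hip) hx // hy.
Qed.

Lemma graph_fst0 (p : W) : gB p -> p.1 = 0 -> p = 0.
Proof.
have [_ [_ B0]] := Bop.
by case: p => f g /= h f0; rewrite /graph /= in h; move: h; rewrite f0 => /B0 ->.
Qed.

Lemma fst_unbounded_graph : fst_unbounded ip gB.
Proof.
move=> M; apply: contrapT => nM; apply: Bunbounded; exists M%:C => f g Bfg.
rewrite /nsq !(ipxx Hip) -rmorphM lecR.
apply: (@le_trans _ _ (sqnorm ip2 (f, g))); first by rewrite sqn2E lerDr sqn_ge0.
by rewrite leNgt; apply/negP => h; apply: nM; exists (f, g).
Qed.

(** The gliding hump is run in the orthogonal complement of [E] and [G]. If [y = e + d], pairing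
    with points orthogonal to [E] sees only [d], so it is bounded by the first component, contrary
    to the choice of [y]. *)
Lemma exists_irregular (E G : seq W) : exists y,
  [/\ gB y, orth ip2 (in_seq G) y &
      ~ exists e d, [/\ span E e, regular_point d & y = e + d]].
Proof.
pose N x := gB x /\ orth ip2 (in_seq (E ++ G)) x.
have [| | |y [[gy oy] hy]] := @exists_unbounded_functional _ _ _ Hip Hcomplete N.
- by apply: subspaceI => //; exact: subspace_orth.
- by apply: closed_setI => //; exact: closed_orth.
- by apply: fst_unbounded_orth => //; [exact: graph_fst0|exact: fst_unbounded_graph].
have orthl x : orth ip2 (in_seq (E ++ G)) x -> orth ip2 (in_seq E) x.
  by move=> h z zE; apply: h; rewrite /in_seq mem_cat zE.
exists y; split=> // [z zG|[e [d [sE [gd [h hd]] yE]]]].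
  by apply: oy; rewrite /in_seq mem_cat zG orbT.
have [x [[gx /orthl ox]]] := hy (sqnorm ip h); apply/negP; rewrite -leNgt.
have -> : re_ip ip2 y x = re_ip ip h x.1.
  rewrite yE ripDl // {1}/re_ip (orth_span Hip2 ox sE) add0r rip_sym //.
  by rewrite (rip_sym Hip x.1) /re_ip hd.
exact: cauchy_schwarz.
Qed.

(** If [h] is orthogonal to the projected complement of [G], the projection [p] of [(h, 0)] on the
    graph is regular and lies in [span G], hence vanishes. So [h] is orthogonal to the domain of
    [B], and [h = 0]. *)
Lemma orth_finite_dense (G : seq W) : (forall x, x \in G -> gB x) ->
  (forall p, span G p -> regular_point p -> p = 0) ->
  forall f e, 0 < e -> exists x, [/\ gB x, orth ip2 (in_seq G) x & sqnorm ip (f - x.1) < e].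
Proof.
move=> gG dG f e e0.
pose N x := gB x /\ orth ip2 (in_seq G) x.
have sN : subspace N by apply: subspaceI => //; exact: subspace_orth.
pose M f := exists x, N x /\ x.1 = f.
suff : dense ip M.
  move=> /(denseP Hip) /(_ f e e0) [_ [[x [[gx ox] <-]] hx]]; by exists x.
apply: dense_of_orth0 => //.
  have [N0 Nlin] := sN; split; first by exists 0.
  by move=> a _ _ [x [Nx <-]] [y [Ny <-]]; exists (a *: x + y); split; [exact: Nlin|].
move=> h oh; have [p [/cB gp op]] := projection Hip2 (ip2_complete Hip Hcomplete) (h, 0) sB.
have hp x : gB x -> ip2 x p = ip x.1 h.
  move=> /op; rewrite ipDr // ipNr // => /eqP; rewrite subr_eq0 => /eqP <-.
  by rewrite /graph_ip /= (ip0r Hip) addr0.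
have rp : regular_point p by split=> //; exists h.
have [w [sw ow]] := span_projection Hip2 G p.
have gw : gB w by apply: span_subspace sw.
have gpw : gB (p - w) by exact: subspaceB.
have pw : p = w.
  apply/eqP; rewrite -subr_eq0; apply/eqP.
  have [_ [_ [_ def]]] := Hip2; apply: def.
  rewrite ipDr // ipNr // (ip_eq0_sym Hip2 (orth_span Hip2 ow sw)) subr0 hp //.
  by apply: oh; exists (p - w).
have p0 : p = 0 by apply: dG => //; rewrite pw.
apply: (orth_dense0 Hip Bdense) => x [g Bxg].
by rewrite -(hp (x, g)) // p0 ip0r.
Qed.

(** Invariant of the induction; the last two clauses let [orth_finite_dense] apply when the opposite
    list is extended. *)
Definition admissible (E G : seq W) : Prop :=
  [/\ forall x, x \in E -> gB x, forall x, x \in G -> gB x,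
      forall x y, x \in E -> y \in G -> ip2 x y = 0,
      forall p, span E p -> regular_point p -> p = 0 &
      forall p, span G p -> regular_point p -> p = 0].

Lemma admissible_sym E G : admissible E G -> admissible G E.
Proof.
by move=> [? ? o ? ?]; split=> // x y xG yE; apply: ip_eq0_sym => //; exact: o.
Qed.

Lemma span_cons_regular E x : (forall p, span E p -> regular_point p -> p = 0) ->
  ~ (exists e d, [/\ span E e, regular_point d & x = e + d]) ->
  forall p, span (x :: E) p -> regular_point p -> p = 0.
Proof.
move=> dE nx _ [c [z [sz ->]]] rp.
have [c0|c0] := eqVneq c 0; first by move: rp; rewrite c0 scale0r add0r; exact: dE.
case: nx; exists (- (c^-1 *: z)), (c^-1 *: (c *: x + z)).
have ss := subspace_span E; split.
- exact: (subspaceN ss (subspaceZ _ ss sz)).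
- exact: (subspaceZ _ subspace_regular_point rp).
by rewrite scalerDr scalerA mulVf // scale1r addrC addrK.
Qed.

(** A good approximation [x] orthogonal to [G] may depend on [E] modulo regular points; adding a
    small multiple of an irregular vector orthogonal to [G] repairs this. *)
Lemma admissible_cons E G f e : admissible E G -> 0 < e ->
  exists x, admissible (x :: E) G /\ sqnorm ip (f - x.1) < e.
Proof.
move=> [gE gG oEG dE dG] e0.
have e8 : 0 < e / 4 by rewrite divr_gt0.
have [x [gx ox hx]] := orth_finite_dense gG dG f e8.
suff [y [gy oy ny hy]] : exists y, [/\ gB y, orth ip2 (in_seq G) y,
    ~ (exists e d, [/\ span E e, regular_point d & y = e + d]) & sqnorm ip (f - y.1) < e].
  exists y; split=> //; split=> //; last exact: span_cons_regular.
    by move=> z; rewrite in_cons => /predU1P[->|/gE].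
  move=> z t; rewrite in_cons => /predU1P[->|]; last exact: oEG.
  by move=> /oy; exact: ip_eq0_sym.
have [[e1 [d1 [se1 rd1 xE]]]|nx] := pselect (exists e d,
    [/\ span E e, regular_point d & x = e + d]); last by exists x; split=> //; lra.
have [y [gy oy ny]] := exists_irregular E G.
have [t [t0 ht]] := exists_small_scale (sqn_ge0 Hip y.1) e8.
have tC : t%:C != 0 by rewrite -(rmorph0 (real_complex R)) (inj_eq (@complexI R)) gt_eqF.
exists (t%:C *: y + x); split.
- by apply sB.
- by apply (subspace_orth Hip2).
- move=> [e2 [d2 [se2 rd2 yE]]]; apply: ny.
  exists (t%:C^-1 *: (e2 - e1)), (t%:C^-1 *: (d2 - d1)).
  have ss := subspace_span E; have sr := subspace_regular_point; split.
  + by apply: (subspaceZ _ ss); exact: (subspaceB ss).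
  + by apply: (subspaceZ _ sr); exact: (subspaceB sr).
  rewrite -scalerDr addrACA -opprD -yE -xE addrK scalerA mulVf // scale1r //.
have -> : f - (t%:C *: y + x).1 = (f - x.1) - t%:C *: y.1.
  by rewrite /= opprD addrA addrAC.
apply: le_lt_trans (sqnD_le Hip _ _) _; rewrite sqnN // sqnZr //; lra.
Qed.

Record splitting (M1 M2 : W -> Prop) : Prop := Splitting {
  splitting_subspace1 : subspace M1;
  splitting_subspace2 : subspace M2;
  splitting_closed1 : closed_set ip2 M1;
  splitting_closed2 : closed_set ip2 M2;
  splitting_graph1 : forall x, M1 x -> gB x;
  splitting_graph2 : forall x, M2 x -> gB x;
  splitting_orth : forall x y, M1 x -> M2 y -> ip2 x y = 0;
  splitting_sum : forall x, gB x -> exists y z, [/\ M1 y, M2 z & x = y + z];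
  splitting_dense1 : dense ip (fun f => exists x, M1 x /\ x.1 = f);
  splitting_dense2 : dense ip (fun f => exists x, M2 x /\ x.1 = f) }.

Lemma splitting_sym M1 M2 : splitting M1 M2 -> splitting M2 M1.
Proof.
move=> [s1 s2 c1 c2 g1 g2 o s d1 d2]; split=> // [x y Mx My|x /s [y [z [My Mz ->]]]].
  by apply: ip_eq0_sym => //; exact: o.
by exists z, y; split=> //; rewrite addrC.
Qed.

Lemma exists_splitting (E0 G0 : seq W) : admissible E0 G0 ->
  (exists d : nat -> V, dense ip (fun x => exists n, x = d n)) ->
  exists M1 M2, [/\ splitting M1 M2, forall x, x \in E0 -> M1 x
                  & forall x, x \in G0 -> M2 x].
Proof.
move=> adm0 [d dd].
pose state := {s : seq W * seq W | admissible s.1 s.2}.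
(* [n] codes a pair [(k, l)], asking for closeness to [d k] at scale [l], so every [d k] is
   approached at every scale. Numbers coding no pair impose nothing. *)
pose near n (f : V) : bool := if unpickle n is Some (k, l) then
  sqnorm ip (d k - f) < (l : nat).+1%:R^-1 else true.
have step n (s : state) : exists t : state, exists x y,
    [/\ sval t = (x :: (sval s).1, y :: (sval s).2), near n x.1 & near n y.1].
  case: s => [[E G] /= aEG].
  have [f [e [e0 hf]]] : exists f e, 0 < e /\ forall x, sqnorm ip (f - x) < e -> near n x.
    rewrite /near; case: (unpickle n) => [[k l]|]; last by exists 0, 1; rewrite ltr01.
    by exists (d k), (l.+1%:R^-1); rewrite invr_gt0.
  have [x [/admissible_sym ax hx]] := admissible_cons f aEG e0.
  have [y [/admissible_sym ay hy]] := admissible_cons f ax e0.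
  by exists (exist _ (x :: E, y :: G) ay), x, y; split=> //; exact: hf.
have /choice[nxt hnxt] (ns : nat * state) : exists t : state, exists x y,
    [/\ sval t = (x :: (sval ns.2).1, y :: (sval ns.2).2), near ns.1 x.1 & near ns.1 y.1].
  exact: step.
pose S := fix S n : state := if n is m.+1 then nxt (m, S m)
                            else exist _ (E0, G0) adm0.
have Smono m n x : (m <= n)%N ->
    (x \in (sval (S m)).1 -> x \in (sval (S n)).1) /\
    (x \in (sval (S m)).2 -> x \in (sval (S n)).2).
  move=> /subnKC <-; elim: (n - m)%N => [|k [IH1 IH2]]; first by rewrite addn0.
  rewrite addnS /=; have [u [v [-> _ _]]] := hnxt (m + k, S (m + k))%N.
  by rewrite /= !in_cons; split=> h; [rewrite IH1 ?orbT|rewrite IH2 ?orbT].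
pose E x := exists n, x \in (sval (S n)).1; pose G x := exists n, x \in (sval (S n)).2.
have EgB x : E x -> gB x by move=> [n]; case: (svalP (S n)) => h _ _ _ _; exact: h.
have GgB x : G x -> gB x by move=> [n]; case: (svalP (S n)) => _ h _ _ _; exact: h.
have EG x y : E x -> G y -> ip2 x y = 0.
  move=> [n xn] [m ym]; have [_ _ h _ _] := svalP (S (maxn n m)).
  by apply: h; [apply: (Smono n _ _ _).1|apply: (Smono m _ _ _).2] => //;
    rewrite ?leq_maxl ?leq_maxr.
have app (P : W -> Prop) : (forall n, exists x, P x /\ near n x.1) ->
    dense ip (fun f => exists x, P x /\ x.1 = f).
  move=> hP; apply/(denseP Hip) => f e e0.
  have e4 : 0 < e / 4 by rewrite divr_gt0.
  have [_ [[k ->] hk]] := (denseP Hip _).1 dd f _ e4.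
  have [l hl] := inv_succ_lt e4; have [x [Px]] := hP (pickle (k, l)).
  rewrite /near pickleK /= => hx; exists x.1; split; first by exists x.
  apply: le_lt_trans (sqn_triangle Hip (d k) _ _) _.
  move: (lt_trans hx (hl l (leqnn l))); clear hx; lra.
(* [M1] contains [E] and [M2] contains [G], which gives dense projections; taking complements makes
   both closed with the whole graph as sum. *)
pose M2 x := gB x /\ orth ip2 E x; pose M1 x := gB x /\ orth ip2 M2 x.
have sM2 : subspace M2 by apply: subspaceI => //; exact: subspace_orth.
have cM2 : closed_set ip2 M2 by apply: closed_setI => //; exact: closed_orth.
have EM1 x : E x -> M1 x.
  by move=> Ex; split=> [|y [_ oy]]; [exact: EgB|apply: ip_eq0_sym => //; exact: oy].
have GM2 x : G x -> M2 x by move=> Gx; split=> [|y Ey]; [exact: GgB|exact: EG].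
exists M1, M2; split=> [|x xE|x xG]; last 2 first.
- by apply: EM1; exists 0%N.
- by apply: GM2; exists 0%N.
split=> //.
- by apply: subspaceI => //; exact: subspace_orth.
- by apply: closed_setI => //; exact: closed_orth.
- by move=> x [].
- by move=> x [].
- by move=> x y [_ ox] My; apply: ip_eq0_sym => //; exact: ox.
- move=> x gx; have [w [/cM2 Mw ow]] := projection Hip2 (ip2_complete Hip Hcomplete) x sM2.
  exists (x - w), w; rewrite subrK; split=> //; split=> //.
  by apply: subspaceB => //; case: Mw.
- apply: app => n; have [u [v [h hu _]]] := hnxt (n, S n).
  by exists u; split=> //; apply: EM1; exists n.+1; rewrite /= h /= mem_head.
- apply: app => n; have [u [v [h _ hv]]] := hnxt (n, S n).
  by exists v; split=> //; apply: GM2; exists n.+1; rewrite /= h /= mem_head.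
Qed.

(** The vector [h] representing [p] is orthogonal to the first components of [M2], which are dense,
    so [h = 0] and [p] is orthogonal to itself. *)
Lemma splitting_regular M1 M2 p : splitting M1 M2 -> M1 p -> regular_point p -> p = 0.
Proof.
move=> sp Mp [gp [h hp]].
have h0 : h = 0.
  apply: (orth_dense0 Hip (splitting_dense2 sp)) => _ [x [Mx <-]].
  rewrite -hp; last exact: (splitting_graph2 sp).
  by apply: ip_eq0_sym => //; exact: (splitting_orth sp).
have [_ [_ [_ def]]] := Hip2; apply: def.
by rewrite hp // h0 ip0r.
Qed.

Lemma splitting_disjoint M1 M2 p : splitting M1 M2 -> M1 p -> M2 p -> p = 0.
Proof.
move=> sp Mp Mp'; have [_ [_ [_ def]]] := Hip2; apply: def.
exact: (splitting_orth sp).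
Qed.

(** For distinct [m] and [n], the half containing [e m] differs from the half orthogonal to [g n],
    because [e m] and [g n] are not orthogonal. *)
Lemma exists_splittings : (exists d : nat -> V, dense ip (fun x => exists n, x = d n)) ->
  exists M : nat -> (W -> Prop) * (W -> Prop),
    (forall n, splitting (M n).1 (M n).2) /\
    (forall m n, m <> n -> ~ (forall x, (M m).1 x <-> (M n).1 x)).
Proof.
move=> sep.
have [a [ga _ na]] := exists_irregular [::] [::].
have [b [gb ob nb]] := exists_irregular [:: a] [:: a].
have a0 : ip2 a a <> 0.
  have [_ [_ [_ def]]] := Hip2; move=> /def a0; apply: na; exists 0, 0.
  by rewrite addr0; split=> //; case: subspace_regular_point.
have b0 : ip2 b b <> 0.
  have [_ [_ [_ def]]] := Hip2; move=> /def b0; apply: nb; exists 0, 0.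
  rewrite addr0; split=> //; first by case: (subspace_span [:: a]).
  by case: subspace_regular_point.
have ab : ip2 a b = 0 by apply: ob; rewrite /in_seq mem_head.
have ba : ip2 b a = 0 by exact: ip_eq0_sym.
(* pairwise non-orthogonal starting vectors [e n], [g m] for [m <> n] *)
pose k : R[i] := ip2 b b / ip2 a a.
have kR : conjc k = k.
  by rewrite /k rmorphM /= fmorphV /= -!ip_sym.
pose e (n : nat) := n%:R *: b + a; pose g (n : nat) := b - (n%:R * k) *: a.
have eg m n : ip2 (e m) (g n) = (m%:R - n%:R) * ip2 b b.
  rewrite /e /g ipDl // ipZl // !(ipDr Hip2) !(ipNr Hip2) !(ipZr Hip2) ab ba.
  rewrite rmorphM /= rmorph_nat kR mulr0 subr0 add0r mulrBl /k; congr (_ - _).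
  by rewrite -mulrA divfK //; exact/eqP.
(* [a] and [b] are independent modulo regular points, so a nontrivial combination spans a line
   without nonzero regular points. *)
have irr (c c' : R[i]) p : (c, c') <> (0, 0) -> p = c *: b + c' *: a ->
    forall q, span [:: p] q -> regular_point q -> q = 0.
  move=> cc -> q [t [_ [-> ->]]]; rewrite addr0 scalerDr !scalerA => rp.
  have [t0|t0] := eqVneq t 0; first by rewrite t0 !mul0r !scale0r addr0.
  have sr := subspace_regular_point.
  have [c0|c0] := eqVneq c 0.
    have [c'0|c'0] := eqVneq c' 0; first by rewrite c0 c'0 in cc.
    case: na; exists 0, a; rewrite add0r; split=> //.
    move: rp; rewrite c0 mulr0 scale0r add0r => /(subspaceZ (t * c')^-1 sr).
    by rewrite scalerA mulVf ?scale1r // mulf_neq0.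
  case: nb; exists (- ((t * c)^-1 *: ((t * c') *: a))),
    ((t * c)^-1 *: ((t * c) *: b + (t * c') *: a)).
  split; [|exact: subspaceZ|].
    exists (- ((t * c)^-1 * (t * c'))), 0; split=> //.
    by rewrite addr0 scalerA scaleNr.
  by rewrite scalerDr (scalerA _ (t * c) b) mulVf ?scale1r ?mulf_neq0 // addrC addrK.
have adm n : admissible [:: e n] [:: g n].
  split=> [x|x|x y| |].
  - by rewrite mem_seq1 => /eqP ->; apply sB.
  - by rewrite mem_seq1 => /eqP ->; apply: subspaceB => //; exact: subspaceZ.
  - by rewrite !mem_seq1 => /eqP -> /eqP ->; rewrite eg subrr mul0r.
  - by apply: (irr n%:R 1) => [[_ /eqP]|]; rewrite ?oner_eq0 // scale1r.
  - by apply: (irr 1 (- (n%:R * k))) => [[/eqP]|]; rewrite ?oner_eq0 // scale1r scaleNr.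
have /choice[M hM] n : exists M : (W -> Prop) * (W -> Prop),
    [/\ splitting M.1 M.2, M.1 (e n) & M.2 (g n)].
  have [M1 [M2 [sp h1 h2]]] := exists_splitting (adm n) sep.
  by exists (M1, M2); split=> //; [apply: h1|apply: h2]; rewrite mem_head.
exists M; split=> [n|m n mn eqM]; first by have [] := hM n.
have [_ em _] := hM m; have [spn _ gn] := hM n.
have := splitting_orth spn ((eqM _).1 em) gn; rewrite eg => /eqP.
rewrite mulf_eq0 subr_eq0 eqr_nat => /orP[/eqP //|/eqP]; exact: b0.
Qed.

End Splitting.

(** * Adjoints, products with adjoints and comparison of resolvents *)

Section Adjoints.
Variables (R : realType) (V : lmodType R[i]) (ip : V -> V -> R[i]).
Hypothesis Hip : is_inner_product ip.
Hypothesis Hcomplete : forall u, cauchy_seq ip u -> exists x, converges ip u x.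
Local Notation ip2 := (graph_ip ip).
Local Notation rip := (re_ip ip).
Local Notation sqn := (sqnorm ip).
Local Notation adj := (adj ip).
Let Hip2 : is_inner_product ip2 := ip2_inner_product Hip.

Lemma op_linear (T : op V) (a : R[i]) f g f' g' : is_op T ->
  T f g -> T f' g' -> T (a *: f + f') (a *: g + g').
Proof. by move=> [_ [h _]]; exact: h. Qed.

Lemma op_sub2 (T : op V) f g f' g' : is_op T -> T f g -> T f' g' -> T (f - f') (g - g').
Proof.
move=> hT Tf Tf'; have := op_linear (-1) hT Tf' Tf.
by rewrite !scaleN1r addrC (addrC (- g')).
Qed.

(** As the orthogonal complement of a rotated graph, the graph of an adjoint is closed. *)
Lemma adj_graph_orth (T : op V) p :
  graph (adj T) p <-> orth ip2 (fun q => T (- q.2) q.1) p.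
Proof.
case: p => h k; split=> [hk [g f] /= /hk|hk f g Tfg].
  by rewrite ipNl // /graph_ip /= => ->; rewrite addNr.
have := hk (g, - f); rewrite /= opprK => /(_ Tfg) /eqP.
by rewrite /graph_ip /= ipNl // subr_eq0 => /eqP.
Qed.

Lemma closed_adj (T : op V) : closed_set ip2 (graph (adj T)).
Proof.
move=> p hp; apply/adj_graph_orth; apply: (closed_orth Hip2) => e /hp [q [hq ?]].
by exists q; split=> //; exact/adj_graph_orth.
Qed.

Lemma is_op_adj (T : op V) : densely_defined ip T -> is_op (adj T).
Proof.
move=> dT; split; first by move=> f g _; rewrite !ip0r.
split=> [a f g f' g' hf hf' u v Tuv|g hg].
  by rewrite !ipDr // !ipZr // (hf _ _ Tuv) (hf' _ _ Tuv).
by apply: (orth_dense0 Hip dT) => f [k /hg]; rewrite ip0r // => <-.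
Qed.

Lemma is_op_comp (S T : op V) : is_op S -> is_op T -> is_op (comp S T).
Proof.
move=> hS hT; have [S0 [Sl S1]] := hS; have [T0 [Tl T1]] := hT.
split; first by exists 0.
split=> [a f g f' g' [u [? ?]] [u' [? ?]]|g [u [/T1 -> /S1]] //].
by exists (a *: u + u'); split; [exact: Tl|exact: Sl].
Qed.

Lemma adj_anti (S T : op V) : op_sub S T -> op_sub (adj T) (adj S).
Proof. by move=> h f g hf u v /h; exact: hf. Qed.

Lemma subspace_dom (T : op V) : is_op T -> subspace (dom T).
Proof.
move=> hT; split; first by exists 0; have [] := hT.
by move=> a f f' [g Tf] [g' Tf']; exists (a *: g + g'); exact: op_linear.
Qed.

Lemma adj_flip (T : op V) f g h k : adj T h k -> T f g -> ip h g = ip k f.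
Proof. by move=> hk /hk e; rewrite (ip_sym Hip g) e -ip_sym. Qed.

Lemma comp_adj_sym (T : op V) f g f' g' :
  comp T (adj T) f g -> comp T (adj T) f' g' -> ip g f' = ip f g'.
Proof.
move=> [u [fu ug]] [u' [fu' ug']].
by rewrite (fu' _ _ ug) (adj_flip fu ug').
Qed.

Lemma nonneg_comp_adj (S T : op V) : op_sub S T -> nonneg ip (comp S (adj T)).
Proof.
move=> ST f g [u [fu /ST ug]]; rewrite (fu _ _ ug).
by have [_ [_ [pos _]]] := Hip.
Qed.

(* von Neumann: [T T^*] is self-adjoint because [T T^* + 1] is onto, which is the
   decomposition of [(0, h)] along the graph of [T] and its orthogonal complement. *)
Lemma selfadjoint_comp_adj (T : op V) : is_op T -> closed_op ip T ->
  densely_defined ip T -> selfadjoint ip (comp T (adj T)).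
Proof.
move=> hT cT dT; have hA := is_op_comp hT (is_op_adj dT).
have onto h : exists b k, comp T (adj T) b k /\ k + b = h.
  have [[f g] [/((closed_graphP Hip T).1 cT) Tfg o]] :=
    projection Hip2 (ip2_complete Hip Hcomplete) (0, h) (subspace_graph hT).
  exists (h - g), g; split; last by rewrite addrC subrK.
  exists f; split=> // u v Tuv; have := o (u, v) Tuv.
  by rewrite /graph_ip /= sub0r (ipNr Hip) addrC => /eqP; rewrite subr_eq0 => /eqP.
split.
  apply: dense_of_orth0 => //; first exact: subspace_dom.
  move=> h oh; have [b [k [Ab bk]]] := onto h.
  have : rip b h = 0 by rewrite /re_ip oh //; exists k.
  rewrite -bk ripDr // (rip_sym Hip k) => h0.
  have : 0 <= ip k b by apply: (nonneg_comp_adj (S := T) (T := T)) Ab => ?.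
  rewrite lecE => /andP[_ /= kb].
  have b0 : b = 0.
    apply: (sqn_eq0 Hip); apply/eqP; rewrite eq_le sqn_ge0 // andbT.
    by move: h0 kb; rewrite /sqnorm /re_ip; lra.
  by rewrite b0 in Ab; have [_ [_ A0]] := hA; rewrite b0 (A0 _ Ab) addr0.
move=> h k; split=> [Ahk f g Afg|hk]; first exact: (comp_adj_sym Afg Ahk).
(* [h - b] is orthogonal to the range of [T T^* + 1], which is everything, so [h = b]. *)
have [b [l [Ab bl]]] := onto (k + h).
have [f [g [Af fg]]] := onto (h - b).
have e1 : ip (g + f) (h - b) = 0.
  have e : ip f (k + h) = ip f (l + b) by rewrite bl.
  rewrite !(ipDr Hip) in e.
  rewrite (ipDr Hip) (ipNr Hip) !(ipDl Hip) (hk _ _ Af) (comp_adj_sym Af Ab).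
  by rewrite e subrr.
have hb : h = b.
  apply/eqP; rewrite -subr_eq0; apply/eqP.
  by have [_ [_ [_ def]]] := Hip; apply: def; rewrite -{1}fg.
suff -> : k = l by rewrite hb.
by apply: (addIr b); rewrite bl hb.
Qed.

Lemma selfadjoint_sym (T : op V) f g f' g' : selfadjoint ip T ->
  T f g -> T f' g' -> rip g f' = rip f g'.
Proof. by move=> [_ e] Tf /e /(_ _ _ Tf); rewrite /re_ip => ->. Qed.

Lemma nonneg_rip (T : op V) f g : nonneg ip T -> T f g -> 0 <= rip g f.
Proof. by move=> h /h; rewrite lecE => /andP[]. Qed.

(* Both numbers compared by [res_le] are real, so it suffices to compare real parts. *)
Lemma res_le_rip (S T : op V) (a : R) : nonneg ip S -> nonneg ip T -> 0 < a ->
  (forall f1 g1 f2 g2, S f1 g1 -> T f2 g2 -> g1 + a%:C *: f1 = g2 + a%:C *: f2 ->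
     rip f1 (g1 + a%:C *: f1) <= rip f2 (g2 + a%:C *: f2)) ->
  res_le ip S T a%:C.
Proof.
move=> nS nT a0 h _ f1 f2 [g1 [Sf <-]] [g2 [Tf e]].
have real (X : op V) f g : nonneg ip X -> X f g ->
    ip f (g + a%:C *: f) = (rip f (g + a%:C *: f))%:C.
  move=> nX Xf; rewrite /re_ip RRe_real // ger0_real //.
  rewrite ipDr // ipZr // conjc_real; apply: addr_ge0.
    by rewrite ip_sym // conj_ge0 nX.
  by have [_ [_ [pos _]]] := Hip; rewrite mulr_ge0 // ler0c ltW.
by rewrite -{2}e (real _ _ _ nS Sf) (real _ _ _ nT Tf) lecR h.
Qed.

(** * The product [T B^*] when 0 is of regular type for [B] *)

Section RegularType.
Variables (B T : op V).
Hypotheses (Bop : is_op B) (Bclosed : closed_op ip B) (Bdense : densely_defined ip B).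
Hypotheses (Top : is_op T) (Tclosed : closed_op ip T) (Tdense : densely_defined ip T).
Hypothesis TB : op_sub T B.
Hypothesis Breg : regular_type0 ip B.
Local Notation A := (comp T (adj B)).

Lemma regular_rip : exists c : R, 0 < c /\ forall f g, B f g -> c * sqn f <= sqn g.
Proof.
have [c [/posc_realE [cE c0] h]] := Breg; exists (Re c); split=> // f g /h.
by rewrite {1}cE /nsq !(ipxx Hip) -rmorphM lecR.
Qed.

(** The form sending [B f] to [ip f u] is bounded on the range of [B], because [B f] controls [f];
    its representing vector is the preimage. The constant [sqn u / c] comes from completing the
    square. *)
Lemma adj_surjective u : exists h, adj B h u.
Proof.
have [c [c0 hc]] := regular_rip.
have [||v _ [f [Bfv ->]]|w [_ hw _]] := riesz Hip Hcomplete
    (P := fun v r => exists f, B f v /\ r = ip f u) (C := sqn u / c).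
- by exists 0; rewrite ip0l //; split=> //; case: Bop.
- move=> a v r v' r' [f [Bf ->]] [f' [Bf' ->]]; exists (a *: f + f').
  by split; [exact: op_linear|rewrite ipDl // ipZl].
- have := hc _ _ Bfv; have := sqn_ge0 Hip (c%:C *: f - u).
  rewrite sqnB // sqnZr // ripZl // -/(rip f u) => h1 h2.
  have -> : sqn u / c = (c ^+ 2 * sqn f - 2 * (c * rip f u) + sqn u) / c
      - c * sqn f + 2 * rip f u by field; rewrite gt_eqF.
  have : 0 <= (c ^+ 2 * sqn f - 2 * (c * rip f u) + sqn u) / c.
    by rewrite divr_ge0 // ltW.
  lra.
by exists w => f g Bfg; rewrite -(hw g (ip f u)) //; exists f.
Qed.

(** The range of [B] is closed, since convergence of [B f] forces convergence of [f], and its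
    orthogonal complement is the kernel of [B^*]. *)
Lemma range_of_orth_ker k : (forall h, adj B h 0 -> ip h k = 0) -> exists f, B f k.
Proof.
move=> hk; have [c [c0 hc]] := regular_rip.
have sM : subspace (fun v => exists f, B f v).
  split; first by exists 0; case: Bop.
  by move=> a x y [f Bf] [f' Bf']; exists (a *: f + f'); exact: op_linear.
have [w [Mw ow]] := projection Hip Hcomplete k sM.
have kw : k = w.
  apply/eqP; rewrite -subr_eq0; apply/eqP.
  have [_ [_ [_ def]]] := Hip; apply: def.
  rewrite {2}(_ : k - w = k + - w) // ipDr // ipNr // hk.
    by rewrite (ip_eq0_sym Hip (orth_adh Hip sM Mw ow)) subrr.
  by move=> f g Bfg; rewrite ip0r // ow //; exists f.
rewrite kw; have [d d0|d d' f f' [g [Bf hg]] [g' [Bf' hg']]|f hf] :=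
    limit_of_approximants Hip Hcomplete
      (A := fun d f => exists g, B f g /\ sqn (w - g) < d) (K := 2 / c).
- by have [g [[f Bf] hg]] := Mw d d0; exists f, g.
- rewrite mulrAC ler_pdivlMr // mulrC.
  apply: le_trans (hc _ _ (op_sub2 Bop Bf Bf')) _.
  apply: le_trans (sqn_triangle Hip w _ _) _; rewrite (sqnBC Hip g); lra.
exists f; apply: ((closed_graphP Hip B).1 Bclosed (f, w)) => e e0.
have e2 : 0 < e / 2 by rewrite divr_gt0.
have [d [f' [d0 de [g [Bf hg]] hf']]] := hf _ e2.
by exists (f', g); split=> //; rewrite sqn2E /=; lra.
Qed.

Lemma restriction_op : is_op A.
Proof. exact: (is_op_comp Top (is_op_adj Bdense)). Qed.

Lemma ker_restriction h : adj B h 0 -> A h 0.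
Proof. by move=> hh; exists 0; split=> //; case: Top. Qed.

(** A vector [h] orthogonal to [dom A] is orthogonal to [ker B^*], so [h = B f]. Every [u] in
    [dom T] is some [B^* k] with [k] in [dom A], so [f] is orthogonal to [dom T]. *)
Lemma restriction_dense : densely_defined ip A.
Proof.
apply: dense_of_orth0 => //; first exact: subspace_dom restriction_op.
move=> h oh; have [f Bf] : exists f, B f h.
  by apply: range_of_orth_ker => k /ker_restriction Ak; apply: oh; exists 0.
have f0 : f = 0.
  apply: (orth_dense0 Hip Tdense) => u [g Tug].
  have [k ku] := adj_surjective u.
  by rewrite -(adj_flip ku Bf) oh //; exists g, u.
by have [_ [_ B0]] := Bop; move: Bf; rewrite f0; exact: B0.
Qed.

Lemma restriction_sub : op_sub A (comp B (adj B)).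
Proof. by move=> f g [u [fu /TB ug]]; exists u. Qed.

Lemma restriction_symmetric : symmetric_op ip A.
Proof.
split; first exact: restriction_dense.
move=> f g /restriction_sub Af f' g' /restriction_sub Af'; exact: (comp_adj_sym Af' Af).
Qed.

(* That is, [dom A] is a core for the form of [B B^*]. *)
Lemma restriction_core g v : adj B g v ->
  adh ip2 (fun p => adj B p.1 p.2 /\ dom T p.2) (g, v).
Proof.
move=> gv; have sa : subspace (graph (adj B)) := subspace_graph (is_op_adj Bdense).
set N := fun p => _.
have sN : subspace N.
  split; first by split; [case: sa|exists 0; case: Top].
  move=> a x y [hx Tx] [hy Ty]; split; first by apply sa.
  by apply (subspace_dom Top).
have [w [Nw ow]] := projection Hip2 (ip2_complete Hip Hcomplete) (g, v) sN.
have aw : graph (adj B) w.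
  by apply: closed_adj => e /Nw [y [[ay _] hy]]; exists y.
have : graph (adj B) ((g, v) - w) by exact: (subspaceB sa (x := (g, v))).
suff z p : graph (adj B) p -> orth ip2 N p -> p = 0.
  move=> /z /(_ ow) /eqP; rewrite subr_eq0 => /eqP ->; exact: Nw.
(* A point orthogonal to [N] has the form [(B f, - f)]; being in the graph of [B^*] it satisfies
   [|B f|^2 = - |f|^2]. *)
case: p => g' v'; rewrite /graph /= => gv' op.
have [f Bf] : exists f, B f g'.
  apply: range_of_orth_ker => h h0; have := op (h, 0).
  by rewrite /graph_ip /= ip0l // addr0; apply; split=> //; exists 0; case: Top.
have vf : f + v' = 0.
  apply: (orth_dense0 Hip Tdense) => u [k Tu]; have [h hu] := adj_surjective u.
  have := op (h, u); rewrite /graph_ip /= ipDr // (adj_flip hu Bf); apply.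
  by split=> //; exists k.
have := gv' _ _ Bf; move/eqP: vf; rewrite addrC addr_eq0 => /eqP ->.
rewrite ipNr // !ipxx // -rmorphN => /complexI e.
have [g0 f0] : sqn g' = 0 /\ sqn f = 0.
  by have := sqn_ge0 Hip g'; have := sqn_ge0 Hip f; split; lra.
by rewrite (sqn_eq0 Hip g0) (sqn_eq0 Hip f0) oppr0.
Qed.

(** Positivity of [C] at [f2 - ph], with [ph] in [dom A] approximating [f1] in the graph norm of
    [B^*], gives the comparison in the limit. *)
Lemma restriction_friedrichs : is_friedrichs ip A (comp B (adj B)).
Proof.
have nF : nonneg ip (comp B (adj B)) by exact: nonneg_comp_adj.
split; first split.
- exact: is_op_comp Bop (is_op_adj Bdense).
- split; first exact: selfadjoint_comp_adj.
  by split=> //; exact: restriction_sub.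
move=> C [Cop [saC [nC AC]]] a' /posc_realE [aE a0]; rewrite aE.
move: (Re a') a0 => {a' aE} a a0.
apply: res_le_rip => // f1 g1 f2 g2 [v [f1v vg]] Cf2 e.
(* The defect is [|v - u|^2 + a |f1 - ph|^2], at most [(1 + a) t]. *)
apply: (@le_of_forall_lt _ _ _ (1 + a)) => t /(restriction_core f1v).
move=> [[ph u] [/= [phu [ps Tu]]]]; rewrite sqn2E /= => ht.
have Cph : C ph ps by apply: AC; exists u.
have := nonneg_rip nC (op_sub2 Cop Cf2 Cph).
have h1 : rip ps f2 = rip ph g2 := selfadjoint_sym saC Cph Cf2.
have h2 : rip ps ph = sqn u by rewrite /sqnorm /re_ip (phu _ _ (TB Tu)).
have h3 : rip g1 ph = rip v u by rewrite /re_ip (phu _ _ vg).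
have h4 : rip g1 f1 = sqn v by rewrite /sqnorm /re_ip (f1v _ _ vg).
have h5 : rip (g1 + a%:C *: f1) ph = rip (g2 + a%:C *: f2) ph by rewrite e.
move: h5; rewrite !ripE // h1 h2 h3 (rip_sym Hip g1 f1) h4 (rip_sym Hip g2 f2).
have := sqn_ge0 Hip (f1 - ph); have : 0 <= a * sqn (f2 - ph) by rewrite mulr_ge0 ?sqn_ge0 // ltW.
have : a * sqn (f1 - ph) <= a * t.
  by rewrite ler_pM2l //; have := sqn_ge0 Hip (v - u); lra.
move: ht; rewrite !sqnB // (rip_sym Hip g2 ph) /sqnorm; lra.
Qed.

(** [A] vanishes on [ker B^*], so [k] is orthogonal to it and equals some [B w]; testing on
    preimages under [B^*] of vectors of [dom T] shows [w = T^* h]. *)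
Lemma restriction_adj : op_eq (adj A) (comp B (adj T)).
Proof.
move=> h k; split=> [hk|[w [hw Bw]] f g [u [fu Tu]]]; last first.
  by rewrite (hw _ _ Tu) (adj_flip fu Bw).
have [w Bw] : exists w, B w k.
  by apply: range_of_orth_ker => l /ker_restriction /hk <-; rewrite ip0l.
exists w; split=> // u g Tu; have [f fu] := adj_surjective u.
by rewrite (hk f g) ?(adj_flip fu Bw) //; exists u.
Qed.

(* The form of [T T^*] is dominated by that of any non-negative extension [C] of [A]:
   [T^* ph] represents the form [T u |-> (T u, ph)], and with [B^* k = u] the bound
   [2 Re (T u, ph) - |u|^2 <= (C ph, ph)] is the positivity of [C] at [ph - k]. *)
Lemma krein_form_bound C ph c : nonneg_sa_ext ip A C -> C ph c ->
  exists w, adj T ph w /\ sqn w <= rip c ph.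
Proof.
move=> [Cop [saC [nC AC]]] Cph.
have [||v _ [g [Tv ->]]|w [_ hw bw]] := riesz Hip Hcomplete
    (P := fun v r => exists g, T v g /\ r = ip g ph) (C := rip c ph).
- by exists 0; rewrite ip0l //; split=> //; case: Top.
- move=> a v r v' r' [f [Tf ->]] [f' [Tf' ->]]; exists (a *: f + f').
  by split; [exact: op_linear|rewrite ipDl // ipZl].
- have [k kv] := adj_surjective v.
  have Ck : C k g by apply: AC; exists v.
  have := nonneg_rip nC (op_sub2 Cop Cph Ck).
  have h1 : rip c k = rip ph g := selfadjoint_sym saC Cph Ck.
  have h2 : rip g k = sqn v by rewrite /sqnorm /re_ip (kv _ _ (TB Tv)).
  by rewrite !ripE // h1 h2 (rip_sym Hip g) -/(rip g ph); lra.
by exists w; split=> // f g Tf; rewrite -(hw f (ip g ph)) //; exists g.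
Qed.

(** With [w1 = T^* f1] from [krein_form_bound] and [w2 = T^* f2], the comparison is positivity of
    [|w1 - w2|^2 + a |f1 - f2|^2]. *)
Lemma restriction_krein : is_krein ip A (comp T (adj T)).
Proof.
have nK : nonneg ip (comp T (adj T)) by apply: nonneg_comp_adj.
split; first split.
- exact: is_op_comp Top (is_op_adj Tdense).
- split; first exact: selfadjoint_comp_adj.
  by split=> // f g [u [/(adj_anti TB) fu Tu]]; exists u.
move=> C extC a' /posc_realE [aE a0]; rewrite aE.
move: (Re a') a0 => {a' aE} a a0.
have [Cop [saC [nC AC]]] := extC.
apply: res_le_rip => // f1 g1 f2 g2 Cf1 [w2 [f2w Tw]] e.
have [w1 [f1w b1]] := krein_form_bound extC Cf1.
have h1 : rip g2 f1 = rip w2 w1 by rewrite /re_ip (f1w _ _ Tw).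
have h2 : rip g2 f2 = sqn w2 by rewrite /sqnorm /re_ip (f2w _ _ Tw).
have h3 : rip f1 (g1 + a%:C *: f1) = rip f1 (g2 + a%:C *: f2) by rewrite e.
have := sqn_ge0 Hip (w1 - w2); have : 0 <= a * sqn (f1 - f2).
  by rewrite mulr_ge0 ?sqn_ge0 // ltW.
move: h3 b1; rewrite !sqnB // !ripDr // !ripZr // (rip_sym Hip g1 f1).
rewrite (rip_sym Hip g2 f1) (rip_sym Hip g2 f2) h1 h2 (rip_sym Hip w1) /sqnorm; lra.
Qed.

End RegularType.

(** * From splittings of the graph to pairs of restrictions *)

Lemma splitting_good_pair (B : op V) (M1 M2 : V * V -> Prop) :
  is_op B -> closed_op ip B -> symmetric_op ip B -> splitting ip B M1 M2 ->
  good_pair ip B (fun f g => M1 (f, g)) (fun f g => M2 (f, g)).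
Proof.
move=> Bop Bcl [Bd Bsym] sp; have sp' := splitting_sym Hip sp.
have Bfun f g g' : B f g -> B f g' -> g = g'.
  move=> Bf Bf'; have [_ [_ B0]] := Bop; apply/eqP; rewrite -subr_eq0; apply/eqP.
  by apply: B0; have := op_sub2 Bop Bf Bf'; rewrite subrr.
have half N1 N2 : splitting ip B N1 N2 -> let T : op V := fun f g => N1 (f, g) in
    [/\ is_op T, closed_op ip T, densely_defined ip T & op_sub T B] /\
    [/\ forall f, dom T f -> dom (comp (adj B) B) f -> f = 0,
        forall f, dom (comp (adj B) T) f -> f = 0 & forall f, dom (comp T T) f -> f = 0].
  move=> s T; have TB : op_sub T B by move=> f g; exact: (splitting_graph1 s).
  have [N0 Nlin] := splitting_subspace1 s.
  (* If [g] is in the domain of [B^*], then [(f, g)] is a regular point, represented by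
     [f + B^* g]. *)
  have key f g k : T f g -> adj B g k -> f = 0.
    move=> Tf gk; suff : (f, g) = 0 by case.
    apply: (splitting_regular Hip s Tf); split; first exact: TB.
    by exists (f + k) => -[u v] Bu; rewrite /graph_ip /= (gk _ _ Bu) -(ipDr Hip).
  split; split=> //.
  - split=> //; split=> [a f g f' g'|g /TB]; first exact: Nlin.
    by have [_ [_ B0]] := Bop; exact: B0.
  - apply/(closed_graphP Hip T) => -[f g] hp; apply: (splitting_closed1 s) => e /hp.
    by move=> [[u v] [Tu hu]]; exists (u, v).
  - apply/(denseP Hip) => f e /((denseP Hip _).1 (splitting_dense1 s) f) [_ [[[u v] [Nu <-]] hu]].
    by exists u; split=> //; exists v.
  - move=> f [g Tf] [k [g' [Bf gk]]].
    by apply: (key f g k) => //; rewrite (Bfun _ _ _ (TB _ _ Tf) Bf).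
  - by move=> f [k [g [Tf gk]]]; exact: (key f g k).
  - by move=> f [k [g [Tf /TB /Bsym gk]]]; exact: (key f g k).
have [[o1 c1 d1 s1] [r1 r1' r1'']] := half _ _ sp.
have [[o2 c2 d2 s2] [r2 r2' r2'']] := half _ _ sp'.
have dis f : dom (fun f g => M1 (f, g)) f -> dom (fun f g => M2 (f, g)) f -> f = 0.
  move=> [g Mf] [g' Mf']; have gg := Bfun _ _ _ (s1 _ _ Mf) (s2 _ _ Mf').
  by rewrite -gg in Mf'; case: (splitting_disjoint Hip sp Mf Mf').
have dec f : dom B f <-> exists f1 f2,
    dom (fun f g => M1 (f, g)) f1 /\ dom (fun f g => M2 (f, g)) f2 /\ f = f1 + f2.
  split=> [[g Bf]|[f1 [f2 [[g1 /s1 B1] [[g2 /s2 B2] ->]]]]].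
    have [[u v] [[u' v'] [Mu Mu' e]]] := splitting_sum sp (Bf : graph B (f, g)).
    by exists u, u'; split; [exists v|split; [exists v'|case: e]].
  by exists (g1 + g2); have := op_linear 1 Bop B1 B2; rewrite !scale1r.
do 16 (split=> //).
move=> reg; split; [|split].
- move=> T HT; have [[oT cT dT sT]] : [/\ is_op T, closed_op ip T, densely_defined ip T
      & op_sub T B] by case: HT => ->.
  split; first exact: restriction_dense.
  split; first exact: nonneg_comp_adj.
  split; first exact: restriction_symmetric.
  split; first exact: restriction_friedrichs.
  split; first exact: restriction_adj.
  exact: restriction_krein.
- move=> h; split=> [[[g [u [hu Mu]]] [g' [u' [hu' Mu']]]]|h0].
    have [_ [_ /(_ (u - u'))]] := is_op_adj Bd.
    have := op_sub2 (is_op_adj Bd) hu hu'; rewrite subrr => h0 /(_ h0) /eqP.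
    rewrite subr_eq0 => /eqP uu; rewrite -uu in Mu'.
    have u0 : u = 0 by apply: dis; [exists g|exists g'].
    by rewrite -u0.
  by split; exists 0; exact: ker_restriction.
move=> h; split=> [[g [u [hu Bu]]]|[h1 [h2 [[g1 [u1 [hu1 /s1 B1]]] [[g2 [u2 [hu2 /s2 B2]]] ->]]]]].
  (* Split [B^* h] along the two domains and lift the first summand through the surjective [B^*]. *)
  have [u1 [u2 [[g1 M1u] [[g2 M2u] uE]]]] := (dec u).1 (ex_intro _ g Bu).
  have [h1 hu1] := adj_surjective Bop reg u1.
  exists h1, (h - h1); split; first by exists g1, u1.
  split; last by rewrite addrC subrK.
  exists g2, u2; split=> //.
  by have := op_sub2 (is_op_adj Bd) hu hu1; rewrite uE addrAC subrr add0r.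
exists (g1 + g2), (u1 + u2); split.
  by have := op_linear 1 (is_op_adj Bd) hu1 hu2; rewrite !scale1r.
by have := op_linear 1 Bop B1 B2; rewrite !scale1r.
Qed.

End Adjoints.

(* "infinitely many pairs": an injective sequence (pairwise non-equal as operators) *)
Theorem theorem3p32 (R : realType) (V : lmodType R[i]) (ip : V -> V -> R[i])
    (HV : is_sep_inf_hilbert ip) (B : op V)
    (HBop : is_op B) (HBcl : closed_op ip B) (HBsym : symmetric_op ip B)
    (HBunb : ~ bounded ip B) :
  exists P : nat -> op V * op V,
    (forall m n, m <> n -> ~ op_pair_eq (P m) (P n)) /\
    (forall n, good_pair ip B (P n).1 (P n).2).
Proof.
have [Hip [Hcomplete [Hsep _]]] := HV; have [Bdense _] := HBsym.
have [M [hM neqM]] := exists_splittings Hip Hcomplete HBop HBcl Bdense HBunb Hsep.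
exists (fun n => (fun f g => (M n).1 (f, g), fun f g => (M n).2 (f, g))).
split=> [m n mn [/= e _]|n /=]; first by apply: (neqM m n mn) => -[f g]; exact: e.
exact: splitting_good_pair.
Qed.
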